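(* For any $A,B\in\mathcal O$ there exists an optimal map $h:A\to B$. Moreover, if a PL-map $f:A\to B$ is not optimal but minimizes the Lipschitz constant (among all $\mathcal O$-maps from $A$ to $B$), then there is an optimal map $h:A\to B$ such that $A_{\max}(h)\subsetneq A_{\max}(f)$.
   Context: Setting. $G=G_1*\dots*G_p*F_k$, where $(G_i)_{i=1}^p$ is a finite family of groups and $F_k$ is the free group of rank $0\le k<\infty$. A simplicial metric tree is a simplicial tree (not necessarily locally compact) with a complete path metric such that edges are isometric to closed intervals of $\mathbb R$; all branch points are vertices. A $G$-tree is a simplicial metric tree on which $G$ acts simplicially by isometries. A vertex $v$ is redundant if it has degree two and every $g\in G$ fixing $v$ also fixes the edges adjacent to $v$. $\mathcal O=\mathcal O(G,(G_i)_{i=1}^p,F_k)$ is the set of $G$-trees $T$, up to $G$-equivariant isometry, such that: (C0) $T$ has no redundant vertices; (C1) the action is minimal (no proper invariant subtree), with trivial edge stabilizers; (C2) for each $i=1,\dots,p$ there is exactly one orbit of vertices with stabilizer conjugate to $G_i$; (C3) all other vertices have trivial stabilizer. Maps. For $A,B\in\mathcal O$, an $\mathcal O$-map $f:A\to B$ is a $G$-equivariant, Lipschitz continuous, surjective function; $\operatorname{Lip}(f)$ is its smallest Lipschitz constant. A PL-map is an $\mathcal O$-map that is piecewise linear: for every edge $e$ of $A$ the restriction $f|_e$ has constant speed $S_{f,e}\ge 0$ and (if $S_{f,e}>0$) is locally injective. $A_{\max}(f)$ is the subgraph of $A$ consisting of the edges $e$ with $S_{f,e}=\operatorname{Lip}(f)$.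 Gates. A pre-train track structure on a $G$-tree is a $G$-invariant equivalence relation on the set of germs of edges at each vertex; equivalence classes are called gates. The pre-train track structure induced by a PL-map $f$ declares two germs of edges at a vertex equivalent if they have the same non-degenerate $f$-image. A PL-map $f$ is not optimal at a vertex $v$ if $A_{\max}(f)$ has only one gate at $v$ for the structure induced by $f$; otherwise it is optimal at $v$. $f$ is optimal if it is optimal at all vertices. *)

(* Defs.v *)
From HB Require Import structures.
From mathcomp Require Import all_boot all_order all_algebra.
From mathcomp Require Import all_classical all_reals all_analysis.

Set Implicit Arguments.
Unset Strict Implicit.
Unset Printing Implicit Defensive.

Import Order.TTheory GRing.Theory Num.Theory.

Local Open Scope classical_set_scope.
Local Open Scope ring_scope.

Definition is_free_group (I : Type) (F : groupType) (x : I -> F) : Prop :=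
  forall (K : groupType) (y : I -> K),
    exists phi : {multiplicative F -> K},
      (forall i, phi (x i) = y i) /\
      (forall psi : {multiplicative F -> K},
          (forall i, psi (x i) = y i) -> psi =1 phi).

Definition is_free_product (I : Type) (H : I -> groupType) (G : groupType)
    (iota : forall i, {multiplicative H i -> G}) : Prop :=
  forall (K : groupType) (f : forall i, {multiplicative H i -> K}),
    exists phi : {multiplicative G -> K},
      (forall i x, phi (iota i x) = f i x) /\
      (forall psi : {multiplicative G -> K},
          (forall i x, psi (iota i x) = f i x) -> psi =1 phi).

(** The factors of [G_1 * ... * G_p * F]: [Some i] is [G_i], [None] is [F]. *)
Definition free_factor (p : nat) (Gs : 'I_p -> groupType) (F : groupType)
    (o : option 'I_p) : groupType :=
  if o is Some i then Gs i else F.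

Section Length.
Variables (R : realType) (X : metricType R).

Definition seq_length (x : X) (s : seq X) : R :=
  \sum_(0 <= n < size s) mdist (nth x (x :: s) n) (nth x (x :: s) n.+1).

Definition path_length (c : R -> X) (a b : R) : \bar R :=
  ereal_sup [set (seq_length (c a) (map c s))%:E | s in itv_partition a b].

End Length.

Section Graph.
Variables (R : realType) (X : metricType R).
Variables (V : set X) (E : set (set X)).

Definition edge_chart (e : set X) (l : R) (c : R -> X) : Prop :=
  [/\ 0 < l,
      forall s t, s \in `[0, l] -> t \in `[0, l] ->
        mdist (c s) (c t) = `|s - t|,
      e = c @` [set` `[0, l]]
    & e `&` V = [set c 0; c l]].

(** A step [(e, w)] crosses the edge [e] and arrives at
    the vertex [w]. *)
Fixpoint walk (v : X) (s : seq (set X * X)) : Prop :=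
  if s is (e, w) :: s' then [/\ E e, e `&` V = [set v; w] & walk w s']
  else True.

Definition graph_connected : Prop :=
  forall v w, V v -> V w -> exists2 s, walk v s & last v (unzip2 s) = w.

(** No simple closed circuit; a pair of edges with the same ends counts as
    one. *)
Definition graph_acyclic : Prop :=
  forall v s, V v -> walk v s -> last v (unzip2 s) = v ->
    uniq (unzip1 s) -> uniq (unzip2 s) -> s = [::].

(** Finite sequences of points whose consecutive terms share an edge, i.e.
    piecewise linear paths of the graph. *)
Definition pl_path (x : X) (s : seq X) : Prop :=
  path (fun y z => `[< exists2 e, E e & e y /\ e z >]) x s.

(** The distance is the path metric of the metric graph. Paths are taken in
    the graph, not in the metric topology: otherwise the Euclidean disk, as
    the union of its radii, would be a star-shaped tree. *)
Definition path_metric : Prop :=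
  forall x y : X,
    mdist x y = inf [set seq_length x s | s in
                       [set s | pl_path x s /\ last x s = y]].

End Graph.

Definition complete_space (R : realType) (X : metricType R) : Prop :=
  forall F : set_system X, ProperFilter F -> cauchy F -> exists x : X, F --> x.

(** Edges are closed segments, as subsets of the tree. Points off the vertex
    set lie inside exactly one edge, so branch points are vertices. *)
Record metric_tree (R : realType) := MetricTree {
  tree_space :> metricType R;
  vert : set tree_space;
  edge : set (set tree_space);
  tree_nonempty : vert !=set0;
  tree_edge_chart : forall e, edge e -> exists l c, edge_chart vert e l c;
  tree_cover : vert `|` \bigcup_(e in edge) e = setT;
  tree_edge_meet : forall e e', edge e -> edge e' -> e <> e' ->
    e `&` e' `<=` vert;
  tree_connected : graph_connected vert edge;
  tree_acyclic : graph_acyclic vert edge;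
  tree_path_metric : path_metric edge;
  tree_complete : complete_space tree_space }.

Record gtree (R : realType) (G : groupType) := GTree {
  gtree_tree :> metric_tree R;
  act : G -> gtree_tree -> gtree_tree;
  act_one : forall x, act 1%g x = x;
  act_mul : forall g h x, act (g * h)%g x = act g (act h x);
  act_isometry : forall g x y, mdist (act g x) (act g y) = mdist x y;
  act_vert : forall g v, vert v -> vert (act g v);
  act_edge : forall g e, edge e -> edge (act g @` e) }.

Arguments vert {R} m.
Arguments edge {R} m.

Section DeformationSpace.
Variables (R : realType) (G : groupType).
Implicit Type T : gtree R G.

Definition stabilizer T (x : T) : set G := [set g | act g x = x].

Definition edges_at T (v : T) : set (set T) := [set e | edge T e /\ e v].

(** For [g] fixing [v], [act g @` e = e] is the same as fixing [e] pointwise. *)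
Definition redundant T (v : T) : Prop :=
  (exists e1 e2, e1 <> e2 /\ edges_at v = [set e1; e2]) /\
  (forall g, stabilizer v g -> forall e, edges_at v e -> act g @` e = e).

Definition minimal_action T : Prop :=
  forall S : set T, S !=set0 -> connected S ->
    (forall g x, S x -> S (act g x)) -> S = setT.

(** Setwise stabilizers, so edge inversions are excluded too. *)
Definition trivial_edge_stabilizers T : Prop :=
  forall e g, edge T e -> act g @` e = e -> g = 1%g.

Definition conjugate_sets (A B : set G) : Prop :=
  exists h, A = [set (h * b * h^-1)%g | b in B].

(** Points of the deformation space are represented by trees; no quotient by
    equivariant isometry is taken. *)
Definition in_outer_space (p : nat) (Gs : 'I_p -> groupType) (F : groupType)
    (iota : forall o, {multiplicative free_factor Gs F o -> G}) T : Prop :=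
  let of_type i (v : T) :=
    vert T v /\ conjugate_sets (stabilizer v) (range (iota (Some i))) in
  [/\ (forall v, vert T v -> ~ redundant v),
      minimal_action T /\ trivial_edge_stabilizers T,
      (forall i, exists v, of_type i v /\
         forall w, of_type i w -> exists g, w = act g v)
    & (forall v, vert T v ->
         (exists i, of_type i v) \/ stabilizer v = [set 1%g])].

End DeformationSpace.

Section Maps.
Variables (R : realType) (G : groupType) (A B : gtree R G).
Implicit Types (f : A -> B) (e : set A) (v : A).

Definition lipschitz_consts f : set R :=
  [set K | 0 <= K /\ forall x y, mdist (f x) (f y) <= K * mdist x y].

Definition Lip f : R := inf (lipschitz_consts f).

Definition O_map f : Prop :=
  [/\ forall g x, f (act g x) = act g (f x),
      lipschitz_consts f !=set0
    & forall y, exists x, f x = y].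

Definition constant_speed f e (S : R) : Prop :=
  exists l c, edge_chart (vert A) e l c /\
    forall s t, 0 <= s -> s <= t -> t <= l ->
      path_length (f \o c) s t = (S * (t - s))%:E.

Definition locally_injective_on f e : Prop :=
  forall x, e x -> exists2 U, nbhs x U &
    forall y z, (U `&` e) y -> (U `&` e) z -> f y = f z -> y = z.

Definition PL_map f : Prop :=
  O_map f /\
  forall e, edge A e -> exists S,
    [/\ 0 <= S, constant_speed f e S & 0 < S -> locally_injective_on f e].

Definition A_max f : set (set A) :=
  [set e | edge A e /\ constant_speed f e (Lip f)].

(** A tree has no loops, so the germs of edges at [v] correspond to the edges
    containing [v]; the germ of [e] at [v] is encoded by the filter of
    neighbourhoods of [v] in [e], and its [f]-image by the image filter. *)
Definition germ_image f v e : set_system B := f @ within e (nbhs v).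

Definition nondegenerate_germ f v e : Prop :=
  ~ (\forall y \near within e (nbhs v), f y = f v).

(** The pre-train track structure induced by [f] at [v]; a germ with
    degenerate image is equivalent only to itself. *)
Definition germ_equiv f v e e' : Prop :=
  e = e' \/
  [/\ nondegenerate_germ f v e, nondegenerate_germ f v e'
    & germ_image f v e = germ_image f v e'].

Definition gate f v e : set (set A) :=
  [set e' | edges_at v e' /\ germ_equiv f v e e'].

Definition A_max_gates f v : set (set (set A)) :=
  [set gate f v e | e in A_max f `&` edges_at v].

(** Exactly one gate: [f] is optimal at the vertices outside [A_max f]. *)
Definition not_optimal_at f v : Prop := exists C, A_max_gates f v = [set C].

Definition optimal f : Prop :=
  PL_map f /\ forall v, vert A v -> ~ not_optimal_at f v.

End Maps.

(* Main.v *)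
Require Import Defs.
From HB Require Import structures.
From mathcomp Require Import all_boot all_order all_algebra.
From mathcomp Require Import all_classical all_reals all_analysis.
From mathcomp Require Import ring lra.

Set Implicit Arguments.
Unset Strict Implicit.
Unset Printing Implicit Defensive.

Import Order.TTheory GRing.Theory Num.Theory.
Import numFieldNormedType.Exports.

Local Open Scope classical_set_scope.
Local Open Scope ring_scope.

(** Rooting a metric tree at a vertex gives the ancestor order and the height [h]
    of a point; [h x + h y] minus twice the height of the common ancestors of [x]
    and [y] satisfies the triangle inequality and agrees with the distance on each
    edge, hence it is the path metric. So the tree is geodesic and satisfies the
    four-point condition.

    A map can be replaced by its straightening, which is affine on each edge and
    agrees with it on vertices; by cocompactness its Lipschitz constant is the
    maximum of finitely many edge stretches. If a straight map has one gate at
    [v], then [v] has trivial stabilizer, and moving the image of [v] (and,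
    equivariantly, of its orbit) a little along the common initial segment of
    the images of the maximally stretched edges at [v] shortens all of these
    while the other edges stay below the maximum. When the Lipschitz constant is
    minimal, this removes an orbit of edges from [A_max], so it stops at an
    optimal map.

    A minimal Lipschitz constant exists although [B] need not be locally compact.
    Take a minimizing sequence, and choose for each vertex orbit of [A] a limit
    point, modulo [G], of its images. Moving the images by small amounts into the
    [G]-orbits of these limit points keeps the sequence minimizing, and the
    distances between points of finitely many [G]-orbits form a discrete set, so
    the infimum is attained. *)

(** * Edges and walks *)

Lemma eq_set2 (T : Type) (a b c d : T) :
  [set a; b] = [set c; d] -> (a = c /\ b = d) \/ (a = d /\ b = c).
Proof.
move=> eq_s.
have : [set a; b] c by rewrite eq_s; left.
have : [set a; b] d by rewrite eq_s; right.
have : [set c; d] a by rewrite -eq_s; left.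
have : [set c; d] b by rewrite -eq_s; right.
by move=> /= -[] ? [] ? [] ? [] ?; subst; by [left | right].
Qed.

Section TreeEdges.
Variables (R : realType) (T : metric_tree R).
Implicit Types (e : set T) (a b v w x y : T) (s : seq (set T * T)).

Definition ends e a b : Prop := edge T e /\ e `&` vert T = [set a; b].

Lemma ends_sym e a b : ends e a b -> ends e b a.
Proof. by move=> [Ee eV]; split; rewrite // eV setUC. Qed.

Lemma edge_ends e : edge T e -> exists a b, ends e a b.
Proof.
move=> Ee; have [l [c [_ _ _ eV]]] := tree_edge_chart Ee.
by exists (c 0), (c l).
Qed.

Lemma ends_chart e a b : ends e a b ->
  exists l c, [/\ edge_chart (vert T) e l c, c 0 = a & c l = b].
Proof.
move=> [Ee eV]; have [l [c [l0 ciso cim cV]]] := tree_edge_chart Ee.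
have [[-> ->]|[-> ->]] := eq_set2 (etrans (esym eV) cV); first by exists l, c.
exists l, (fun u : R => c (l - u)); split; rewrite ?subr0 ?subrr //; split => //.
- move=> s t; rewrite !in_itv /= => /andP[s0 sl] /andP[t0 tl].
  rewrite ciso ?in_itv /= ?subr_ge0 ?gerBl ?sl ?tl //.
  by rewrite distrC (_ : l - t - (l - s) = s - t) //; ring.
- rewrite {1}cim; apply/seteqP; split=> x [s /=]; rewrite in_itv /= => /andP[s0 sl] <-.
    exists (l - s); rewrite /= ?in_itv /= ?subr_ge0 ?gerBl ?sl ?s0 //.
    by rewrite subKr.
  exists (l - s); rewrite /= ?in_itv /= ?subr_ge0 ?gerBl ?sl ?s0 //.
- by rewrite subr0 subrr cV setUC.
Qed.

Lemma ends_memP e a b : ends e a b -> [/\ e a, e b, vert T a & vert T b].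
Proof.
move=> [_ eV]; have : [set a; b] a by left. have : [set a; b] b by right.
by rewrite -eV => -[? ?] [].
Qed.

Lemma ends_vert e a b v : ends e a b -> vert T v -> e v -> v = a \/ v = b.
Proof. by move=> [_ eV] Vv ev; have : (e `&` vert T) v by []; rewrite eV. Qed.

Lemma ends_dist_gt0 e a b : ends e a b -> 0 < mdist a b.
Proof.
move=> /ends_chart[l [c [[l0 ciso _ _] <- <-]]].
rewrite ciso ?in_itv /= ?lexx ?ltW // sub0r normrN gtr0_norm //.
Qed.

Lemma ends_neq e a b : ends e a b -> a <> b.
Proof. by move=> /ends_dist_gt0 + ab; rewrite ab mdistxx ltxx. Qed.

Lemma edge_dist e a b x y : ends e a b -> e x -> e y ->
  mdist x y = `|mdist a x - mdist a y|.
Proof.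
move=> /ends_chart[l [c [[l0 ciso -> _] <- _]]] [s /= sl <-] [t /= tl <-].
have i0 : 0 \in `[0, l] by rewrite in_itv /= lexx ltW.
rewrite !ciso //; move: sl tl; rewrite !in_itv /= => /andP[? ?] /andP[? ?].
by rewrite !sub0r !normrN [`|s|]ger0_norm // [`|t|]ger0_norm.
Qed.

Lemma edge_dist_ends e a b x : ends e a b -> e x ->
  mdist a x + mdist x b = mdist a b.
Proof.
move=> /ends_chart[l [c [[l0 ciso -> _] <- <-]]] [s /= sl <-].
have i0 : 0 \in `[0, l] by rewrite in_itv /= lexx ltW.
have il : l \in `[0, l] by rewrite in_itv /= lexx ltW.
rewrite !ciso //; move: sl; rewrite !in_itv /= => /andP[s0 sl].
rewrite !sub0r !normrN (ger0_norm s0) (gtr0_norm l0) distrC ger0_norm ?subr_ge0 //.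
by rewrite addrC subrK.
Qed.

Lemma edge_point e a b t : ends e a b -> 0 <= t <= mdist a b ->
  exists x, e x /\ mdist a x = t.
Proof.
move=> /ends_chart[l [c [[l0 ciso -> _] <- <-]]].
have i0 : 0 \in `[0, l] by rewrite in_itv /= lexx ltW.
have il : l \in `[0, l] by rewrite in_itv /= lexx ltW.
rewrite !ciso // sub0r normrN (gtr0_norm l0) => /andP[t0 tl].
have it : t \in `[0, l] by rewrite in_itv /= t0.
exists (c t); split; first by exists t.
by rewrite ciso // sub0r normrN ger0_norm.
Qed.

Lemma cover_point x : vert T x \/ exists2 e, edge T e & e x.
Proof.
have : setT x by []. rewrite -(tree_cover T) => -[|[e]]; first by left.
by right; exists e.
Qed.

Lemma edge_unique e e' x : edge T e -> edge T e' -> e x -> e' x -> ~ vert T x ->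
  e = e'.
Proof.
move=> Ee Ee' ex ex' nVx; apply: contrapT => ne.
by apply: nVx; apply: (tree_edge_meet Ee Ee' ne).
Qed.

End TreeEdges.

Section Walks.
Variables (R : realType) (T : metric_tree R).
Implicit Types (e : set T) (a b p v w x y : T) (s : seq (set T * T)).

Local Notation twalk := (walk (vert T) (edge T)).

Definition simple_walk v s : Prop := twalk v s /\ uniq (v :: unzip2 s).

Lemma walk_cons v w e s : twalk v ((e, w) :: s) <-> ends e v w /\ twalk w s.
Proof. by split=> [[]|[[]]]. Qed.

Lemma walk_cat v s s' :
  twalk v (s ++ s') <-> twalk v s /\ twalk (last v (unzip2 s)) s'.
Proof.
elim: s v => [|[e w] s IHs] v /=; first by tauto.
by split=> [[? ? /IHs[]]|[[? ? ?] ?]]; split=> //; apply/IHs.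
Qed.

Lemma walk_rcons v s e w :
  twalk v (rcons s (e, w)) <-> twalk v s /\ ends e (last v (unzip2 s)) w.
Proof. by rewrite -cats1 walk_cat walk_cons /=; tauto. Qed.

Lemma last_unzip2_rcons v s e w : last v (unzip2 (rcons s (e, w))) = w.
Proof. by rewrite /unzip2 map_rcons last_rcons. Qed.

Lemma walk_rev v s : twalk v s -> exists s',
  [/\ twalk (last v (unzip2 s)) s', last (last v (unzip2 s)) (unzip2 s') = v
    & {subset unzip1 s' <= unzip1 s}].
Proof.
elim: s v => [|[e w] s IHs] v; first by exists [::].
move=> /walk_cons[evw /IHs[s' [s'w s'v s's]]].
exists (rcons s' (e, v)); split; rewrite ?last_unzip2_rcons //.
  by apply/walk_rcons; split; rewrite // s'v; apply: ends_sym.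
move=> f; rewrite /unzip1 map_rcons mem_rcons !inE /= => /orP[->//|/s's ->].
by rewrite orbT.
Qed.

Lemma walk_split v s w : w \in v :: unzip2 s ->
  exists s1 s2, s = s1 ++ s2 /\ last v (unzip2 s1) = w.
Proof.
elim: s v => [|[e u] s IHs] v; first by rewrite inE => /eqP ->; exists [::], [::].
rewrite inE => /orP[/eqP ->|].
- by exists [::], ((e, u) :: s).
- by move=> /IHs[s1 [s2 [-> <-]]]; exists ((e, u) :: s1), s2.
Qed.

Lemma simple_walk_catl v s s' : simple_walk v (s ++ s') -> simple_walk v s.
Proof.
move=> [/walk_cat[vs _]]; rewrite /unzip2 map_cat -cat_cons cat_uniq.
by case/andP.
Qed.

Lemma walk_shorten v s : twalk v s -> exists s',
  [/\ simple_walk v s', last v (unzip2 s') = last v (unzip2 s)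
    & {subset unzip1 s' <= unzip1 s}].
Proof.
elim/last_ind: s => [|s [e w] IHs]; first by exists [::].
move=> /walk_rcons[/IHs[s' [[vs' us'] ls' ss']] ew].
have sub : {subset unzip1 s <= unzip1 (rcons s (e, w))}.
  by move=> f; rewrite /unzip1 map_rcons mem_rcons inE => ->; rewrite orbT.
case: (boolP (w \in v :: unzip2 s')) => [|ws'].
  move=> /walk_split[s1 [s2 [s'E ls1]]]; exists s1; split.
  - by apply: (@simple_walk_catl _ _ s2); rewrite -s'E.
  - by rewrite last_unzip2_rcons.
  - move=> f fs1; apply/sub/ss'; rewrite s'E /unzip1 map_cat mem_cat.
    by rewrite -/(unzip1 s1) fs1.
exists (rcons s' (e, w)); split; rewrite ?last_unzip2_rcons //.
  split; first by apply/walk_rcons; rewrite ls'.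
  by rewrite /unzip2 map_rcons -rcons_cons rcons_uniq ws'.
move=> f; rewrite /unzip1 !map_rcons !mem_rcons !inE => /orP[->//|/ss'].
by rewrite -/(unzip1 s) => ->; rewrite orbT.
Qed.

Lemma walk_edge_ends v s e : twalk v s -> e \in unzip1 s ->
  exists a b, [/\ ends e a b, a \in v :: unzip2 s & b \in v :: unzip2 s].
Proof.
elim: s v => [//|[f w] s IHs] v /walk_cons[fvw ws].
rewrite inE => /orP[/eqP ->|/(IHs _ ws)[a [b [eab ina inb]]]].
  by exists v, w; split; rewrite // !inE eqxx ?orbT.
by exists a, b; split; rewrite // inE ?ina ?inb orbT.
Qed.

(** Both ends of an edge crossed by a walk are among its vertices, and this walk never visits
    [v]. *)
Lemma walk_edge_notin v s e : vert T v -> e v -> ~~ (v \in unzip2 s) ->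
  forall w, twalk w s -> w != v -> ~~ (e \in unzip1 s).
Proof.
move=> Vv ev vs w ws wv; apply/negP => /(walk_edge_ends ws)[a [b [eab ina inb]]].
have vws : ~~ (v \in w :: unzip2 s) by rewrite inE negb_or eq_sym wv.
by case: (ends_vert eab Vv ev) => vE; rewrite vE ?ina ?inb in vws.
Qed.

Lemma simple_walk_uniq_edges v s : vert T v -> simple_walk v s -> uniq (unzip1 s).
Proof.
elim: s v => [//|[e w] s IHs] v Vv [/walk_cons[evw ws]] /= /andP[vns us].
have [ev _ _ Vw] := ends_memP evw.
rewrite (IHs w) // andbT.
move: vns; rewrite inE negb_or => /andP[vw vs].
by apply: (walk_edge_notin Vv ev vs ws); rewrite eq_sym.
Qed.

(* Otherwise the shortened walk, closed up by [e], would be a circuit. *)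
Lemma walk_crosses e a b s : ends e a b -> twalk a s -> last a (unzip2 s) = b ->
  e \in unzip1 s.
Proof.
move=> eab aws sb; apply: contraT => nes.
have [s' [[as' us'] ls' ss']] := walk_shorten aws.
have [_ _ Va Vb] := ends_memP eab.
suff : rcons s' (e, a) = [::] by case: s' {as' us' ls' ss'}.
apply: (tree_acyclic Va).
- by apply/walk_rcons; split; rewrite // ls' sb; apply: ends_sym.
- by rewrite last_unzip2_rcons.
- rewrite /unzip1 map_rcons rcons_uniq (simple_walk_uniq_edges Va) // andbT.
  by apply: contra nes => /ss'.
- by rewrite /unzip2 map_rcons rcons_uniq.
Qed.

(** If two walks left [v] by different edges [e] and [e'], then the rest of the first, the reverse
    of the rest of the second and [e'] would join the ends of [e] without crossing [e], against
    [walk_crosses]. *)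
Lemma simple_walk_unique v s s' : vert T v -> simple_walk v s -> simple_walk v s' ->
  last v (unzip2 s) = last v (unzip2 s') -> s = s'.
Proof.
elim: s s' v => [|[e w] s IHs] [|[e' w'] s'] v Vv //.
- move=> _ [_] /= /andP[vs' _] vE.
  by move: (mem_last w' (unzip2 s')); rewrite -vE (negPf vs').
- move=> [_] /= /andP[vs _] _ vE.
  by move: (mem_last w (unzip2 s)); rewrite vE (negPf vs).
move=> [/walk_cons[evw ws]] /= /andP[vns us] [/walk_cons[evw' ws']] /= /andP[vns' us'].
have [ev ew _ Vw] := ends_memP evw; have [_ ew' _ Vw'] := ends_memP evw'.
case: (eqVneq e e') => [ee|ee] ls.
  have ww : w = w'.
    rewrite -ee in evw'.
    by have [wv|//] := ends_vert evw' Vw ew; case: (ends_neq evw).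
  by subst w'; rewrite -ee; congr (_ :: _); apply: (IHs s' w Vw).
move: vns vns'; rewrite !inE !negb_or => /andP[vw vs] /andP[vw' vs'].
have nes : e \notin unzip1 s.
  by apply: (walk_edge_notin Vv ev vs ws); rewrite eq_sym.
have nes' : e \notin unzip1 s'.
  by apply: (walk_edge_notin Vv ev vs' ws'); rewrite eq_sym.
have [r [rw lr sr]] := walk_rev ws'.
suff : false by [].
have := @walk_crosses e w v (s ++ rcons r (e', v)) (ends_sym evw).
rewrite /unzip1 map_cat mem_cat map_rcons mem_rcons inE (negPf nes) (negPf ee) /=.
rewrite (negPf (contra (sr e) nes')); apply=> //.
  apply/walk_cat; split=> //; apply/walk_rcons; rewrite ls; split=> //.
  by rewrite lr; apply: ends_sym.
by rewrite /unzip2 map_cat map_rcons last_cat last_rcons.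
Qed.

Lemma simple_walk_exists v w : vert T v -> vert T w ->
  exists s, simple_walk v s /\ last v (unzip2 s) = w.
Proof.
move=> Vv Vw; have [s vs sw] := tree_connected Vv Vw.
by have [s' [? ls' _]] := walk_shorten vs; exists s'; rewrite ls'.
Qed.

(** If [b] has been visited, the part of [s] up to [b] followed by [e] is a simple walk to [a],
    hence equal to [s]. This orients each edge away from or towards the root [p]. *)
Lemma simple_walk_step p s e a b : vert T p -> simple_walk p s ->
  last p (unzip2 s) = a -> ends e a b ->
  simple_walk p (rcons s (e, b)) \/
  exists s', [/\ s = rcons s' (e, a), simple_walk p s' & last p (unzip2 s') = b].
Proof.
move=> Vp [ps us] sa eab.
case: (boolP (b \in p :: unzip2 s)) => [bs|bs]; last first.
  left; split; first by apply/walk_rcons; rewrite sa.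
  by rewrite /unzip2 map_rcons -rcons_cons rcons_uniq bs.
right; have [s1 [s2 [sE s1b]]] := walk_split bs.
have sims : simple_walk p (s1 ++ s2) by rewrite -sE.
have [ps1 us1] := simple_walk_catl sims.
exists s1; split=> //.
apply: (simple_walk_unique Vp) => //; last by rewrite last_unzip2_rcons.
split; first by apply/walk_rcons; split; rewrite // s1b; apply: ends_sym.
rewrite /unzip2 map_rcons -rcons_cons rcons_uniq us1 andbT /=.
move: us sa; rewrite sE /unzip2 map_cat last_cat -/(unzip2 s1) s1b.
case: s2 {sE sims} => [_ /= ba|[f u] s2].
  by have := ends_neq eab; rewrite -ba.
rewrite -cat_cons cat_uniq => /and3P[_ /hasPn h _] /= <-.
by apply: h; apply: mem_last.
Qed.

End Walks.

(** * The tree metric *)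

Section SeqLength.
Variables (R : realType) (X : metricType R).

Fixpoint chain_length (x : X) (s : seq X) : R :=
  if s is y :: s' then mdist x y + chain_length y s' else 0.

Lemma seq_lengthE (x : X) (s : seq X) : seq_length x s = chain_length x s.
Proof.
rewrite /seq_length.
have gen (z : X) : forall (x0 : X), \sum_(0 <= n < size s)
    mdist (nth z (x0 :: s) n) (nth z (x0 :: s) n.+1) = chain_length x0 s.
  elim: s => [|y s IHs] x0 /=; first by rewrite big_nil.
  by rewrite big_nat_recl //= -(IHs y).
exact: gen.
Qed.

Lemma chain_length_cat (x : X) (s s' : seq X) :
  chain_length x (s ++ s') = chain_length x s + chain_length (last x s) s'.
Proof. by elim: s x => [|y s IHs] x /=; rewrite ?add0r // IHs addrA. Qed.

Lemma chain_length_rcons (x y : X) (s : seq X) :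
  chain_length x (rcons s y) = chain_length x s + mdist (last x s) y.
Proof. by rewrite -cats1 chain_length_cat /= addr0. Qed.

Lemma chain_length_ge0 (x : X) (s : seq X) : 0 <= chain_length x s.
Proof. by elim: s x => [|y s IHs] x //=; rewrite addr_ge0 ?mdist_ge0. Qed.

End SeqLength.

Section PLPaths.
Variables (R : realType) (T : metric_tree R).

Lemma walk_pl_path (v : T) s : vert T v -> walk (vert T) (edge T) v s ->
  pl_path (edge T) v (unzip2 s).
Proof.
elim: s v => [//|[e w] s IHs] v Vv /walk_cons[evw ws] /=.
have [ev ew _ Vw] := ends_memP evw.
apply/andP; split; last exact: IHs.
by apply/asboolP; exists e => //; case: evw.
Qed.

(** The infimum defining the distance is thus over a nonempty set, which bounds from below by
    [lb_le_inf] require. *)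
Lemma pl_path_exists (x y : T) : exists s, pl_path (edge T) x s /\ last x s = y.
Proof.
have start (z : T) : exists v s, [/\ vert T v, pl_path (edge T) z s, last z s = v &
    pl_path (edge T) v (rcons [::] z) \/ v = z].
  have [Vz|[e Ee ez]] := cover_point z; first by exists z, [::]; split=> //; right.
  have [a [b eab]] := edge_ends Ee; have [ea _ Va _] := ends_memP eab.
  exists a, [:: a]; split=> //; last left; rewrite /pl_path /= andbT;
    by apply/asboolP; exists e.
have [v [s [Vv xs sv _]]] := start x; have [w [_ [Vw _ _ wy]]] := start y.
have [r vr rw] := tree_connected Vv Vw.
have [s2 [ps2 ls2]] : exists s2, pl_path (edge T) w s2 /\ last w s2 = y.
  by case: wy => [wy|->]; [exists [:: y] | exists [::]].
exists (s ++ unzip2 r ++ s2).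
rewrite /pl_path !cat_path !last_cat sv rw; split=> //.
by apply/and3P; split=> //; apply: walk_pl_path.
Qed.

End PLPaths.

(** * The path metric from an abstract ancestor order and height *)

Section RootedMetric.
Variables (R : realType) (T : metric_tree R) (p : T) (h : T -> R) (anc : T -> T -> Prop).
Hypothesis h_root : h p = 0.
Hypothesis anc_root : forall x, anc p x.
Hypothesis anc_refl : forall x, anc x x.
Hypothesis anc_trans : forall x y z, anc x y -> anc y z -> anc x z.
Hypothesis anc_le : forall u x, anc u x -> h u <= h x.
Hypothesis anc_chain : forall u v x, anc u x -> anc v x -> h u <= h v -> anc u v.
Hypothesis anc_height : forall x (t : R), 0 <= t <= h x -> exists u, anc u x /\ h u = t.
Hypothesis anc_dist : forall u x, anc u x -> mdist u x <= h x - h u.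
Hypothesis edge_anc : forall e x y, edge T e -> e x -> e y ->
  anc x y /\ mdist x y = h y - h x \/ anc y x /\ mdist x y = h x - h y.

Let common x y := [set h u | u in [set u | anc u x /\ anc u y]].
(* The height of the meet of [x] and [y]. *)
Let m x y : R := sup (common x y).

Let common_sup x y : has_sup (common x y).
Proof.
split; first by exists (h p), p.
by exists (h x) => _ [u [ux _] <-]; apply: anc_le.
Qed.

Let common_le x y u : anc u x -> anc u y -> h u <= m x y.
Proof. by move=> ux uy; apply: sup_upper_bound => //; exists u. Qed.

Let le_common x y c : (forall u, anc u x -> anc u y -> h u <= c) -> m x y <= c.
Proof.
move=> hc; apply: ge_sup => [|_ [u [ux uy] <-]]; first by exists (h p), p.
exact: hc.
Qed.

Let m_sym x y : m x y = m y x.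
Proof.
by apply/eqP; rewrite eq_le; apply/andP; split; apply: le_common => u ? ?;
  apply: common_le.
Qed.

Let m_le x y : m x y <= h x.
Proof. by apply: le_common => u /anc_le. Qed.

Let m_ge0 x y : 0 <= m x y.
Proof. by rewrite -h_root; apply: common_le. Qed.

(** A common ancestor of [x], [y] and one of [y], [z] are both ancestors of [y], hence comparable;
    the lower of them is a common ancestor of [x] and [z]. *)
Let m_ultra x y z : m x y <= m x z \/ m y z <= m x z.
Proof.
have [?|lt1] := leP (m x y) (m x z); first by left.
right; apply: le_common => v vy vz.
rewrite leNgt; apply/negP => lt2.
have [_ [u [ux uy] <-] ltu] := sup_gt (common_sup x y).1 lt1.
have [uv|/ltW vu] := leP (h u) (h v).
  have := @common_le x z u ux (anc_trans (anc_chain uy vy uv) vz).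
  by rewrite leNgt ltu.
have := @common_le x z v (anc_trans (anc_chain vy uy vu) ux) vz.
by rewrite leNgt lt2.
Qed.

Let D x y := h x + h y - m x y *+ 2.

Let D_triangle x y z : D x z <= D x y + D y z.
Proof.
rewrite /D !mulr2n; have h1 := m_le y x; have h2 := m_le y z.
rewrite m_sym in h1.
by case: (m_ultra x y z); lra.
Qed.

Let D_anc x y : anc x y -> D x y = h y - h x.
Proof.
move=> xy; suff mE : m x y = h x by rewrite /D mE mulr2n; lra.
by apply/eqP; rewrite eq_le m_le; apply: common_le.
Qed.

Let D_edge e x y : edge T e -> e x -> e y -> D x y = mdist x y.
Proof.
move=> Ee ex ey; case: (edge_anc Ee ex ey) => -[/D_anc <- ->] //.
by rewrite /D m_sym [h y + _]addrC.
Qed.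

(** The triangle inequality for [D] and its value on edges bound [D x y] by the length of every
    path. Conversely, a detour through any common ancestor bounds the distance from above, and [m]
    is the supremum of the heights of these. *)
Let D_dist x y : D x y = mdist x y.
Proof.
apply/eqP; rewrite eq_le; apply/andP; split; last first.
  suff : m x y <= (h x + h y - mdist x y) / 2 by move=> ?; rewrite /D mulr2n; lra.
  apply: le_common => u ux uy; have := metric_triangle x u y.
  rewrite (metric_sym x u); have := anc_dist ux; have := anc_dist uy; lra.
rewrite (tree_path_metric x y); apply: lb_le_inf.
  by have [s ?] := pl_path_exists x y; exists (seq_length x s), s.
move=> _ [s [xs <-] <-]; rewrite seq_lengthE.
elim: s x xs => [|z s IHs] x /=.
  by rewrite D_anc ?subrr.
move=> /andP[/asboolP[e Ee [ex ez]] zs].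
by apply: le_trans (D_triangle x z _) _; rewrite (D_edge Ee ex ez) lerD2l IHs.
Qed.

Lemma rooted_dist (u x : T) : anc u x -> mdist u x = h x - h u.
Proof. by move=> ux; rewrite -D_dist D_anc. Qed.

Lemma rooted_geodesic (x y : T) (t : R) : 0 <= t <= mdist x y ->
  exists z, mdist x z = t /\ mdist z y = mdist x y - t.
Proof.
move=> /andP[t0]; rewrite -D_dist => td.
(* By symmetry the point sought lies between [x] and the meet, where it is the ancestor of [x] at
   height [h x - t]. *)
wlog tm : x y t t0 td / t <= h x - m x y.
  move=> wl; have [/(wl x y t t0 td)//|/ltW tm] := leP t (h x - m x y).
  have [|||z [yz zx]] := wl y x (D x y - t).
  - by rewrite subr_ge0.
  - by rewrite /D m_sym [h y + _]addrC -/(D x y) gerBl.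
  - by rewrite m_sym /D mulr2n; lra.
  exists z; rewrite metric_sym zx (metric_sym z y) yz /D (m_sym y x).
  by split; lra.
have h1 := m_le x y; have h2 := m_ge0 x y.
have [|u [ux hu]] := @anc_height x (h x - t); first by lra.
(* The point [u] is at least as high as the meet, so it has the same common ancestors with [y] as
   [x] has. *)
have mu : m u y = m x y.
  apply/eqP; rewrite eq_le; apply/andP; split; apply: le_common => v vu vy.
    exact: common_le (anc_trans vu ux) vy.
  apply: (common_le _ vy); apply: (anc_chain vu ux).
  by rewrite hu; have := common_le vu vy; lra.
exists u; rewrite metric_sym (rooted_dist ux) hu -!D_dist /D mu hu; split; lra.
Qed.

(** The heights cancel, and the remaining inequality between the values of [m] follows by cases from
    instances of [m_ultra]. *)
Lemma rooted_fourpoint (x y z w : T) :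
  mdist x y + mdist z w <= mdist x z + mdist y w \/
  mdist x y + mdist z w <= mdist x w + mdist y z.
Proof.
rewrite -!D_dist /D !mulr2n.
suff : m x z + m y w <= m x y + m z w \/ m x w + m y z <= m x y + m z w.
  by case=> ?; [left|right]; lra.
move: (m_ultra x z y) (m_ultra x w y) (m_ultra z x w) (m_ultra z y w).
move: (m_ultra y x z) (m_ultra x w z) (m_ultra x z w).
rewrite (m_sym y x) (m_sym z x) (m_sym z y) (m_sym w y) (m_sym w z).
move: (m x y) (m z w) (m x z) (m y w) (m x w) (m y z) => A B C E F G.
move=> t5 t6 t7 [] ? [] ? [] ? [] ?;
  try (by left; lra); try (by right; lra); case: t5 => ?; case: t6 => ?;
  case: t7 => ?; by [left; lra|right; lra].
Qed.

Lemma rooted_root_dist (x : T) : mdist p x = h x.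
Proof. by rewrite rooted_dist // h_root subr0. Qed.

End RootedMetric.

(** * The ancestor order and height of a tree rooted at a vertex *)

Section Address.
Variables (R : realType) (T : metric_tree R) (p : T).
Hypothesis Vp : vert T p.
Implicit Types (e : set T) (a b u v x y : T) (s : seq (set T * T)).

Let is_address x s : Prop := simple_walk p s /\
  (vert T x /\ last p (unzip2 s) = x \/
   ~ vert T x /\ exists s' e b, s = rcons s' (e, b) /\ e x).

Let address_exists x : exists s, is_address x s.
Proof.
have [Vx|nVx] := pselect (vert T x).
  by have [s [ps sx]] := simple_walk_exists Vp Vx; exists s; split=> //; left.
have [//|[e Ee ex]] := cover_point x.
have [a [b eab]] := edge_ends Ee; have [_ _ Va _] := ends_memP eab.
have [s [ps sa]] := simple_walk_exists Vp Va.
have [ps'|[s' [sE _ _]]] := simple_walk_step Vp ps sa eab.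
  by exists (rcons s (e, b)); split=> //; right; split=> //; exists s, e, b.
by exists s; split=> //; right; split=> //; exists s', e, a.
Qed.

Let address_unique x s s' : is_address x s -> is_address x s' -> s = s'.
Proof.
move=> [ps +] [ps' +] => -[[Vx sx]|[nVx [r [e [b [sE ex]]]]]]
  [[Vx' sx']|[_ [r' [e' [b' [sE' ex']]]]]] //.
  by apply: (simple_walk_unique Vp) => //; rewrite sx sx'.
subst s s'.
have /walk_rcons[pr eb] := ps.1; have /walk_rcons[pr' eb'] := ps'.1.
have ee : e = e' by apply: (edge_unique eb.1 eb'.1 ex ex').
subst e'; apply: (simple_walk_unique Vp) => //; rewrite !last_unzip2_rcons.
have [[_ //]|[lb bl]] := eq_set2 (etrans (esym eb.2) eb'.2).
(* Here the two walks cross [e] in opposite directions, so each of [r] and [r'] would extend the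
   other by one step. *)
have rE : r = rcons r' (e, b').
  apply: (simple_walk_unique Vp) => //; last by rewrite last_unzip2_rcons.
  by move: ps; rewrite -cats1 => /simple_walk_catl.
have rE' : r' = rcons r (e, b).
  apply: (simple_walk_unique Vp) => //; last by rewrite last_unzip2_rcons.
  by move: ps'; rewrite -cats1 => /simple_walk_catl.
have /eqP := congr1 size rE; rewrite rE' !size_rcons => /eqP/esym.
by elim: (size r) => //= n IHn [] /IHn.
Qed.

(** The walk from the root [p] to the vertex [x], or to the far end of the edge
    whose interior contains [x]. *)
Let W x : seq (set T * T) := projT1 (cid (address_exists x)).

Let W_address x : is_address x (W x).
Proof. exact: projT2 (cid (address_exists x)). Qed.

Let WE x s : is_address x s -> W x = s.
Proof. exact: address_unique. Qed.

Let len s : R := chain_length p (unzip2 s).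

Let h x : R := len (W x) - mdist x (last p (unzip2 (W x))).

(** All points of an edge except its end nearer to the root have the same address; the condition on
    heights orders them. *)
Let anc u x : Prop := prefix (W u) (W x) /\ h u <= h x.

(** The edge [e] directed away from the root, with [a] its end nearer to [p]. *)
Let up e a b : Prop := ends e a b /\ W b = rcons (W a) (e, b).

Let len_rcons s e b : len (rcons s (e, b)) = len s + mdist (last p (unzip2 s)) b.
Proof. by rewrite /len /unzip2 map_rcons chain_length_rcons. Qed.

Let W_vert x : vert T x -> last p (unzip2 (W x)) = x.
Proof. by move=> Vx; have [_ [[]|[]]] := W_address x. Qed.

Let h_vert x : vert T x -> h x = len (W x).
Proof. by move=> Vx; rewrite /h W_vert // mdistxx subr0. Qed.

Let edge_up e : edge T e -> exists a b, up e a b.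
Proof.
move=> Ee; have [a [b eab]] := edge_ends Ee; have [_ _ Va Vb] := ends_memP eab.
have [Wab|[s [WE' ps sb]]] := simple_walk_step Vp (W_address a).1 (W_vert Va) eab.
  exists a, b; split=> //; apply: WE; split=> //; left; split=> //.
  by rewrite last_unzip2_rcons.
exists b, a; split; first exact: ends_sym.
by rewrite WE'; congr rcons; apply/esym/WE; split=> //; left.
Qed.

Let up_W e a b x : up e a b -> e x -> x <> a -> W x = W b.
Proof.
move=> [eab Wb] ex xa; have [Vx|nVx] := pselect (vert T x).
  by have [//|->] := ends_vert eab Vx ex.
apply: WE; split; first exact: (W_address b).1.
by right; split=> //; exists (W a), e, b.
Qed.

Let up_h e a b x : up e a b -> e x -> h x = h a + mdist a x.
Proof.
move=> eabU ex; have [->|xa] := pselect (x = a); first by rewrite mdistxx addr0.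
have [eab Wb] := eabU; have [_ _ Va Vb] := ends_memP eab.
rewrite {1}/h (up_W eabU ex xa) (W_vert Vb) Wb len_rcons (W_vert Va) h_vert //.
by have := edge_dist_ends eab ex; lra.
Qed.

Let W_nil x : W x = [::] -> x = p.
Proof.
have [_ [[_ sx]|[_ [s [e [b [-> _]]]]]]] := W_address x.
  by move=> Wx; move: sx; rewrite Wx.
by case: s.
Qed.

Let W_rcons x s e b : W x = rcons s (e, b) ->
  exists a, [/\ up e a b, e x, x <> a & W a = s].
Proof.
move=> Wx; have [[pW uW] Wx'] := W_address x.
have := pW; rewrite Wx => /walk_rcons[ps eab].
have [_ eb Va Vb] := ends_memP eab.
have sims : simple_walk p s.
  by move: (W_address x).1; rewrite Wx -cats1 => /simple_walk_catl.
have Wa : W (last p (unzip2 s)) = s by apply: WE; split=> //; left.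
exists (last p (unzip2 s)); split=> //.
- split=> //; rewrite Wa; apply: WE; split; first by rewrite -Wx; apply: (W_address x).1.
  by left; rewrite last_unzip2_rcons.
- case: Wx' => [[_ <-]|[_ [s' [e' [b' [+ e'x]]]]]]; first by rewrite Wx last_unzip2_rcons.
  by rewrite Wx => /rcons_inj[_ -> _].
- move=> xE; move: Wa; rewrite -xE Wx => /(congr1 size)/eqP.
  by rewrite size_rcons eqn_leq ltnn.
Qed.

Let h_le_len x : h x <= len (W x).
Proof. by rewrite /h gerBl mdist_ge0. Qed.

Let prefix_len s s' : prefix s s' -> len s <= len s'.
Proof.
move=> /prefixP[r ->]; rewrite /len /unzip2 map_cat chain_length_cat lerDl.
exact: chain_length_ge0.
Qed.

Let prefix_total s1 s2 s : prefix s1 s -> prefix s2 s -> prefix s1 s2 \/ prefix s2 s1.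
Proof.
rewrite !prefixE => /eqP s1E /eqP s2E.
have [le12|/ltnW le21] := leqP (size s1) (size s2); [left|right].
  by rewrite -s2E take_takel // s1E.
by rewrite -s1E take_takel // s2E.
Qed.

Let prefix_rconsE s s' z : prefix s (rcons s' z) -> s = rcons s' z \/ prefix s s'.
Proof.
move=> /prefixP[r]; case/lastP: r => [|r z']; first by rewrite cats0; left.
rewrite -rcons_cat => /rcons_inj[-> _]; right; exact: prefix_prefix.
Qed.

Let anc_trans x y z : anc x y -> anc y z -> anc x z.
Proof.
by move=> [xy hxy] [yz hyz]; split; [apply: prefix_trans xy yz|apply: le_trans hxy hyz].
Qed.

Let W_root : W p = [::].
Proof. by apply: WE; split=> //; left. Qed.

Let h_root : h p = 0.
Proof. by rewrite h_vert // W_root. Qed.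

Let h_ge0 x : 0 <= h x.
Proof.
case/lastP Wx : (W x) => [|s [e b]].
  by rewrite /h Wx /= (W_nil Wx) mdistxx subrr.
have [a [eab ex _ _]] := W_rcons Wx; have [_ _ Va _] := ends_memP eab.1.
by rewrite (up_h eab ex) (h_vert Va) addr_ge0 ?mdist_ge0 // chain_length_ge0.
Qed.

Let anc_root x : anc p x.
Proof. by split; rewrite ?W_root ?prefix0s // h_root h_ge0. Qed.

(** The addresses of [u] and [v] are prefixes of one walk. If that of [v] were strictly shorter, the
    height of [v] would be at most that of the near end [a] of the last edge towards [u], which is
    less than [h u]. *)
Let anc_chain u v x : anc u x -> anc v x -> h u <= h v -> anc u v.
Proof.
move=> [ux _] [vx _] huv; split=> //.
have [//|] := prefix_total ux vx.
case/lastP Wu : (W u) => [|s [e b]]; first by rewrite prefix0s.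
move=> /prefix_rconsE[->|vs]; first exact: prefix_refl.
have [a [eab eu ua Wa]] := W_rcons Wu; have [_ _ Va _] := ends_memP eab.1.
have := prefix_len vs; rewrite -Wa -(h_vert Va) => hva.
have : 0 < mdist a u by rewrite mdist_gt0; apply/eqP => /esym/ua.
have := h_le_len v; move: huv; rewrite (up_h eab eu); lra.
Qed.

(** Every point other than the root lies beyond the near end of an edge directed away from the root,
    and this end has a shorter address. *)
Let address_ind (P : T -> Prop) : P p ->
  (forall e a b x, up e a b -> e x -> x <> a -> P a -> P x) -> forall x, P x.
Proof.
move=> Pp IH x; move WE' : (W x) => s.
elim/last_ind: s x WE' => [|s [e b] IHs] x Wx; first by rewrite (W_nil Wx).
by have [a [eab ex xa Wa]] := W_rcons Wx; apply: (IH e a b) => //; apply: IHs.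
Qed.

Let up_anc e a b x y : up e a b -> e x -> e y -> h x <= h y -> anc x y.
Proof.
move=> eab ex ey hxy; split=> //; have [->|xa] := pselect (x = a).
  have [->|ya] := pselect (y = a); first exact: prefix_refl.
  by rewrite (up_W eab ey ya) eab.2 prefix_rcons.
have [ya|ya] := pselect (y = a); last first.
  by rewrite (up_W eab ex xa) (up_W eab ey ya) prefix_refl.
have : 0 < mdist a x by rewrite mdist_gt0; apply/eqP => /esym/xa.
by move: hxy; rewrite ya (up_h eab ex); lra.
Qed.

Let up_mem_near e a b : up e a b -> e a.
Proof. by move=> [/ends_memP[]]. Qed.

Let anc_height x (t : R) : 0 <= t <= h x -> exists u, anc u x /\ h u = t.
Proof.
move: x; apply: address_ind => [|e a b x eab ex xa IH].
  rewrite h_root => /le_anti <-; exists p; split=> //; exact: anc_root.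
move=> /andP[t0 tx]; have [ta|at'] := leP t (h a).
  have [|u [ua hu]] := IH; first by rewrite t0.
  exists u; split=> //; apply: anc_trans ua _.
  apply: (up_anc eab) => //; first exact: up_mem_near eab.
  by rewrite (up_h eab ex) lerDl mdist_ge0.
have hx := up_h eab ex; have := edge_dist_ends eab.1 ex.
have := mdist_ge0 x b => xb axb.
have [|u [eu au]] := @edge_point _ _ e a b (t - h a) eab.1; first by lra.
have hu : h u = t by rewrite (up_h eab eu) au; lra.
by exists u; split=> //; apply: (up_anc eab) => //; rewrite hu.
Qed.

Let anc_dist u x : anc u x -> mdist u x <= h x - h u.
Proof.
move: x; apply: address_ind => [[]|e a b x eab ex xa IH [ux hux]].
  rewrite W_root prefixs0 => /eqP/W_nil -> _; by rewrite mdistxx subrr.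
have hx := up_h eab ex.
have [_ _ Va _] := ends_memP eab.1.
move: ux; rewrite (up_W eab ex xa) eab.2 => /prefix_rconsE[Wu|ua].
  have [a' [_ eu _ _]] := W_rcons Wu.
  rewrite (edge_dist eab.1 eu ex) ler0_norm ?(up_h eab eu) ?hx; first by lra.
  by move: hux; rewrite (up_h eab eu) hx; lra.
have hua : h u <= h a by rewrite (h_vert Va) (le_trans (h_le_len u)) ?prefix_len.
have := IH (conj ua hua); have := metric_triangle u a x; rewrite hx; lra.
Qed.

Let edge_anc e x y : edge T e -> e x -> e y ->
  anc x y /\ mdist x y = h y - h x \/ anc y x /\ mdist x y = h x - h y.
Proof.
move=> Ee ex ey; have [a [b eab]] := edge_up Ee.
have hx := up_h eab ex; have hy := up_h eab ey.
rewrite (edge_dist eab.1 ex ey).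
have [le|/ltW le] := leP (h x) (h y); [left|right].
  by split; [exact: up_anc eab ex ey le|rewrite ler0_norm; lra].
by split; [exact: up_anc eab ey ex le|rewrite ger0_norm; lra].
Qed.

Let anc_refl x : anc x x.
Proof. by split=> //; apply: prefix_refl. Qed.

Let anc_le u x : anc u x -> h u <= h x.
Proof. by case. Qed.

Lemma address_geodesic x y (t : R) : 0 <= t <= mdist x y ->
  exists z, mdist x z = t /\ mdist z y = mdist x y - t.
Proof.
exact: (rooted_geodesic h_root anc_root anc_refl anc_trans anc_le anc_chain anc_height
  anc_dist edge_anc).
Qed.

Lemma address_fourpoint x y z w :
  mdist x y + mdist z w <= mdist x z + mdist y w \/
  mdist x y + mdist z w <= mdist x w + mdist y z.
Proof.
exact: (rooted_fourpoint anc_root anc_refl anc_trans anc_le anc_chain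
  anc_dist edge_anc).
Qed.

Lemma address_root_dist x : vert T x -> exists s,
  [/\ walk (vert T) (edge T) p s, last p (unzip2 s) = x
    & mdist p x = chain_length p (unzip2 s)].
Proof.
move=> Vx; exists (W x); have [[pW _] _] := W_address x.
split=> //; first exact: W_vert.
rewrite -/(len (W x)) -(h_vert Vx).
exact: (rooted_root_dist h_root anc_root anc_refl anc_trans anc_le anc_chain
  anc_dist edge_anc).
Qed.

End Address.

Section TreeMetric.
Variables (R : realType) (T : metric_tree R).
Implicit Types (e : set T) (a b v w x y z : T).

Lemma tree_geodesic x y (t : R) : 0 <= t <= mdist x y ->
  exists z, mdist x z = t /\ mdist z y = mdist x y - t.
Proof. by have [p Vp] := tree_nonempty T; apply: (address_geodesic Vp). Qed.

Lemma tree_fourpoint x y z w :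
  mdist x y + mdist z w <= mdist x z + mdist y w \/
  mdist x y + mdist z w <= mdist x w + mdist y z.
Proof. by have [p Vp] := tree_nonempty T; apply: (address_fourpoint Vp). Qed.

(** With [v] taken as the root, distances between vertices become sums of edge lengths; their
    discreteness rests on this. *)
Lemma vert_dist_walk v w : vert T v -> vert T w -> exists s,
  [/\ walk (vert T) (edge T) v s, last v (unzip2 s) = w
    & mdist v w = chain_length v (unzip2 s)].
Proof. by move=> Vv; apply: address_root_dist. Qed.

(** A path from [x] to [y] must leave [e], and distinct edges meet only in vertices, so it leaves
    through [a] or [b]. Hence its length is at least the smaller of the two detours. *)
Lemma edge_exit e a b x y : ends e a b -> e x -> ~ e y ->
  mdist x y = mdist x a + mdist a y \/ mdist x y = mdist x b + mdist b y.
Proof.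
move=> eab ex ney.
have : Num.min (mdist x a + mdist a y) (mdist x b + mdist b y) <= mdist x y.
  rewrite (tree_path_metric x y); apply: lb_le_inf.
    by have [s ?] := pl_path_exists x y; exists (seq_length x s), s.
  move=> _ [s [xs sy] <-]; rewrite seq_lengthE.
  elim: s x ex xs sy => [|z s IHs] x ex /= xs sy; first by rewrite sy in ex.
  case/andP: xs => /asboolP[f Ef [fx fz]] zs.
  have [ez|nez] := pselect (e z).
    apply: le_trans (lerD (lexx _) (IHs z ez zs sy)).
    rewrite addr_minr !addrA le_min !ge_min !lerD2r !metric_triangle //.
    by rewrite orbT.
  have Vx : vert T x.
    by apply: (tree_edge_meet eab.1 Ef) => // ef; rewrite ef in nez.
  have zy : mdist z y <= chain_length z s.
    rewrite -sy; elim: (s) (z) => [|u r IHr] t /=; first by rewrite mdistxx.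
    by apply: le_trans (metric_triangle t u _) _; rewrite lerD2l.
  have := metric_triangle x z y.
  have [xE|xE] := ends_vert eab Vx ex; rewrite ge_min -xE mdistxx add0r;
    apply: contraTT; lra.
rewrite ge_min => /orP[h|h]; [left|right]; apply/eqP; rewrite eq_le h andbT;
  exact: metric_triangle.
Qed.

End TreeMetric.

(** * Subgroups and generation *)

Section SubgroupType.
Variable G : groupType.

(** Packaged so that a subgroup is itself a [groupType] and can serve as the target in a universal
    property. *)
Record subgroup := Subgroup {
  subgroup_pred :> pred G;
  subgroup_closed : group_closed subgroup_pred }.

Record subgroup_sort (S : subgroup) := SubgroupSort {
  subgroup_val : G;
  subgroup_valP : subgroup_pred S subgroup_val }.

HB.instance Definition _ (S : subgroup) := [isSub for @subgroup_val S].
HB.instance Definition _ (S : subgroup) := [Choice of subgroup_sort S by <:].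
HB.instance Definition _ (S : subgroup) :=
  SubChoice_isSubGroup.Build G (subgroup_pred S) (subgroup_sort S) (subgroup_closed S).

Lemma subgroup_valM (S : subgroup) :
  {morph (@subgroup_val S) : x y / (x * y)%g}.
Proof. by []. Qed.

HB.instance Definition _ (S : subgroup) :=
  isMultiplicative.Build (subgroup_sort S) G (@subgroup_val S) (@subgroup_valM S).

End SubgroupType.

Section Generation.
Variables (G : groupType) (P : set G).
Hypothesis P1 : P 1%g.
Hypothesis PF : forall x y, P x -> P y -> P (x / y)%g.

Let S : subgroup G.
Proof.
exists (fun g => `[< P g >]); split=> [|x y]; first exact/asboolP.
by move=> /asboolP Px /asboolP Py; apply/asboolP; apply: PF.
Defined.

Section Corestriction.
Variables (H : groupType) (f : {multiplicative H -> G}).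
Hypothesis Pf : forall x, P (f x).

Let corestrict x : subgroup_sort S := @SubgroupSort G S (f x) (asboolT (Pf x)).

Let corestrictM : {morph corestrict : x y / (x * y)%g}.
Proof. by move=> x y; apply: val_inj; rewrite /= gmulfM. Qed.

HB.instance Definition _ :=
  isMultiplicative.Build H (subgroup_sort S) corestrict corestrictM.

Lemma corestriction_exists : exists phi : {multiplicative H -> subgroup_sort S},
  forall x, subgroup_val (phi x) = f x.
Proof. by exists corestrict. Qed.

End Corestriction.

(** The maps [iota i] factor through the subgroup [P]. The induced map into [P], followed by the
    inclusion, extends [iota], so by uniqueness it is the identity of [G]. *)
Lemma free_product_ind (I : Type) (H : I -> groupType)
    (iota : forall i, {multiplicative H i -> G}) :
  is_free_product iota -> (forall i x, P (iota i x)) -> forall g, P g.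
Proof.
move=> free Piota g.
pose phi i := projT1 (cid (corestriction_exists (Piota i))).
have phiE i x : subgroup_val (phi i x) = iota i x.
  exact: (projT2 (cid (corestriction_exists (Piota i))) x).
have [psi [psiE _]] := free _ phi.
have [id' [_ id'U]] := free _ iota.
have psi_id : @subgroup_val _ S \o psi =1 id'.
  by apply: id'U => i x /=; rewrite psiE phiE.
have idE : idfun =1 id' by apply: id'U.
by rewrite -[g]/(idfun g) idE -psi_id /=; case: (psi g) => x /= /asboolP.
Qed.

Lemma free_group_ind (I : Type) (x : I -> G) :
  is_free_group x -> (forall i, P (x i)) -> forall g, P g.
Proof.
move=> free Px g.
have [psi [psiE _]] := free (subgroup_sort S) (fun i => @SubgroupSort G S (x i) (asboolT (Px i))).
have [id' [_ id'U]] := free _ x.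
have psi_id : @subgroup_val _ S \o psi =1 id'.
  by apply: id'U => i /=; rewrite psiE.
have idE : idfun =1 id' by apply: id'U.
by rewrite -[g]/(idfun g) idE -psi_id /=; case: (psi g) => y /= /asboolP.
Qed.

End Generation.

Lemma free_factors_ind (p k : nat) (Gs : 'I_p -> groupType) (F : groupType)
    (x : 'I_k -> F) (G : groupType)
    (iota : forall o, {multiplicative free_factor Gs F o -> G}) (P : set G) :
  is_free_group x -> is_free_product iota ->
  P 1%g -> (forall g h, P g -> P h -> P (g / h)%g) ->
  (forall i g, P (iota (Some i) g)) -> (forall j, P (iota None (x j))) ->
  forall g, P g.
Proof.
move=> hF hG P1 PF PS PN; apply: (free_product_ind P1 PF hG) => -[i|] //.
have f1 (f : {multiplicative F -> G}) : f 1%g = 1%g.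
  by apply: (mulgI (f 1%g)); rewrite -gmulfM !mulg1.
have fF (f : {multiplicative F -> G}) : {morph f : g h / (g / h)%g}.
  move=> g h; rewrite gmulfM; congr (_ * _)%g; apply: (mulgI (f h)).
  by rewrite -gmulfM !mulgV.
apply: (@free_group_ind F [set g | P (iota None g)] _ _ _ _ hF PN) => /=.
  by move: P1; rewrite -(f1 (iota None)).
by move=> g h Pg Ph; move: (PF _ _ Pg Ph); rewrite -(fF (iota None)).
Qed.

(** * Cocompactness *)

Section Lipschitz.
Variable R : realType.

Lemma lipschitz_continuous (X Y : metricType R) (f : X -> Y) (K : R) :
  (forall x y, mdist (f x) (f y) <= K * mdist x y) -> continuous f.
Proof.
move=> fK x; apply/metricType_numDomainType.cvgrPdist_lt => eps eps0.
have K0 : 0 < `|K| + 1 by rewrite ltr_wpDl.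
near=> y.
apply: le_lt_trans (fK x y) _; apply: (@le_lt_trans _ _ ((`|K| + 1) * mdist x y)).
  by rewrite ler_wpM2r ?mdist_ge0 // ler_wpDr // ler_norm.
rewrite mulrC -ltr_pdivlMr //.
near: y; apply: metricType_numDomainType.cvgr_dist_lt; first exact: cvg_id.
by rewrite divr_gt0.
Unshelve. all: by end_near. Qed.

(** A chart is controlled on [[0, l]] only. Precomposing it with the retraction of the line onto
    this interval gives a continuous map with the same image, so edges inherit connectedness and
    compactness. *)
Lemma isometric_segment (X : metricType R) (l : R) (c : R -> X) : 0 <= l ->
  (forall s t, s \in `[0, l] -> t \in `[0, l] -> mdist (c s) (c t) = `|s - t|) ->
  exists c' : R -> X, continuous c' /\ c' @` [set` `[0, l]] = c @` [set` `[0, l]].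
Proof.
move=> l0 ciso; pose k (t : R) := Num.max 0 (Num.min t l).
have k_in t : k t \in `[0, l].
  by rewrite in_itv /= /k le_max lexx /= ge_max l0 ge_min lexx orbT.
have k_id t : t \in `[0, l] -> k t = t.
  by rewrite in_itv /= /k => /andP[t0 tl]; rewrite (min_idPl tl) (max_idPr t0).
exists (c \o k); split; last first.
  apply/seteqP; split=> x [t /= tl <-]; exists t => //=; by rewrite k_id.
have kL s t : `|k s - k t| <= `|s - t|.
  have := ler_norm (s - t); have := ler_norm (t - s); rewrite (distrC t s).
  move: `|s - t| => N ts st; rewrite ler_norml /k.
  case: (leP s l) => ?; case: (leP t l) => ?; case: (leP 0 s) => ?;
    case: (leP 0 t) => ?; rewrite ?(max_idPr l0); apply/andP; split; lra.
move=> t; apply/metricType_numDomainType.cvgrPdist_lt => eps eps0.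
near=> s; rewrite /= ciso //; apply: le_lt_trans (kL _ _) _.
near: s; exact: (@cvgr_dist_lt _ _ _ (nbhs t) _ id t).
Unshelve. all: by end_near. Qed.

End Lipschitz.

Section GTree.
Variables (R : realType) (G : groupType) (T : gtree R G).
Implicit Types (e : set T) (a b v w x y : T) (g h : G) (s : seq (set T * T)).

Lemma actK g x : act g^-1%g (act g x) = x.
Proof. by rewrite -act_mul mulVg act_one. Qed.

Lemma actVK g x : act g (act g^-1%g x) = x.
Proof. by rewrite -act_mul mulgV act_one. Qed.

Lemma act_inj g x y : act g x = act g y -> x = y.
Proof. by move=> gxy; rewrite -(actK g x) gxy actK. Qed.

Lemma act_vertE g v : vert T (act g v) <-> vert T v.
Proof. by split; [move=> /(act_vert g^-1%g); rewrite actK|apply: act_vert]. Qed.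

Lemma act_imageM g h (e : set T) : act g @` (act h @` e) = act (g * h)%g @` e.
Proof. by rewrite image_comp; apply: eq_imagel => x _ /=; rewrite act_mul. Qed.

Lemma act_image1 (e : set T) : act 1%g @` e = e.
Proof.
apply/seteqP; split=> x; first by move=> [y ey <-]; rewrite act_one.
by move=> ex; exists x; rewrite ?act_one.
Qed.

Lemma act_imageP g (e : set T) x : (act g @` e) (act g x) <-> e x.
Proof.
by split=> [[y ey /act_inj <-] //|ex]; exists x.
Qed.

Lemma act_ends g e a b : ends e a b -> ends (act g @` e) (act g a) (act g b).
Proof.
move=> eab; split; first by apply: act_edge; case: eab.
have [ea eb Va Vb] := ends_memP eab.
apply/seteqP; split=> x.
  move=> [[y ey <-]]; rewrite act_vertE => Vy.
  by have [->|->] := ends_vert eab Vy ey; [left|right].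
move=> [->|->]; split; rewrite ?act_vertE //; apply/act_imageP => //.
Qed.

Lemma act_continuous g : continuous (act g : T -> T).
Proof. by apply: (@lipschitz_continuous _ _ _ _ 1) => x y; rewrite act_isometry mul1r. Qed.

Lemma edge_connected e : edge T e -> connected e.
Proof.
move=> Ee; have [l [c [l0 ciso -> _]]] := tree_edge_chart Ee.
have [c' [cc' <-]] := isometric_segment (ltW l0) ciso.
apply: connected_continuous_connected; first exact: segment_connected.
exact: continuous_subspaceT.
Qed.

Lemma edge_compact e : edge T e -> compact e.
Proof.
move=> Ee; have [l [c [l0 ciso -> _]]] := tree_edge_chart Ee.
have [c' [cc' <-]] := isometric_segment (ltW l0) ciso.
apply: continuous_compact; last exact: segment_compact.
exact: continuous_subspaceT.
Qed.

Lemma edge_interior e : edge T e -> exists x, e x /\ ~ vert T x.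
Proof.
move=> /edge_ends[a [b eab]]; have ab := ends_dist_gt0 eab.
have [|x [ex ax]] := @edge_point _ _ e a b (mdist a b / 2) eab; first by lra.
exists x; split=> // Vx; move: ax.
by have [->|->] := ends_vert eab Vx ex; rewrite ?mdistxx; lra.
Qed.

(** The point lies on a single edge, which [g] must therefore preserve. *)
Lemma stabilizer_interior g x : trivial_edge_stabilizers T -> ~ vert T x ->
  act g x = x -> g = 1%g.
Proof.
move=> triv nVx gx; have [//|[e Ee ex]] := cover_point x.
apply: (triv e) => //; apply: (@edge_unique _ _ _ _ x) => //; first exact: act_edge.
by rewrite -gx; apply/act_imageP.
Qed.

Lemma edge_linked (S : set T) e x y : edge T e -> e `<=` S -> e x -> e y ->
  connected_component S x y.
Proof. by move=> Ee eS ex ey; exists e => //; split=> //; apply: edge_connected. Qed.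

Lemma walk_linked (S : set T) s v w : walk (vert T) (edge T) v s ->
  (forall e, e \in unzip1 s -> e `<=` S) -> S v -> w \in v :: unzip2 s ->
  connected_component S v w.
Proof.
elim: s v => [|[e u] s IHs] v.
  by move=> _ _ Sv; rewrite inE => /eqP ->; apply: connected_component_refl.
move=> /walk_cons[evu us] sS Sv; rewrite inE => /orP[/eqP ->|ws].
  exact: connected_component_refl.
have [ev eu _ _] := ends_memP evu.
have eS : e `<=` S by apply: sS; rewrite inE eqxx.
apply: (@connected_component_trans _ _ u); first by apply: edge_linked evu.1 eS ev eu.
by apply: IHs => // [f fs|]; [apply: sS; rewrite inE fs orbT|apply: eS].
Qed.

Lemma act_linked (S : set T) g x y : (forall z, S z -> S (act g z)) ->
  connected_component S x y -> connected_component S (act g x) (act g y).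
Proof.
move=> gS [C [Cx CS cC] Cy]; exists (act g @` C); last by exists y.
split; first by exists x.
  by move=> _ [z Cz <-]; apply/gS/CS.
by apply: connected_continuous_connected => //; apply/continuous_subspaceT/act_continuous.
Qed.

Lemma tree_setT_connected : connected [set: T].
Proof.
have [p Vp] := tree_nonempty T.
rewrite -[setT](_ : connected_component [set: T] p = _).
  exact: component_connected.
apply/seteqP; split=> // x _.
have link v : vert T v -> connected_component [set: T] p v.
  move=> Vv; have [s ps <-] := tree_connected Vp Vv.
  by apply: (walk_linked ps) => //; apply: mem_last.
have [/link //|[e Ee ex]] := cover_point x.
have [a [b eab]] := edge_ends Ee; have [ea _ Va _] := ends_memP eab.
by apply: connected_component_trans (link a Va) _; apply: (@edge_linked _ e).
Qed.

(** Cocompactness of the action; several listed edges may belong to the same orbit. *)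
Definition edge_reps (es : seq (set T)) : Prop :=
  (forall e, e \in es -> edge T e) /\
  (forall e, edge T e -> exists e0 g, e0 \in es /\ e = act g @` e0).

(** The translates of the walks [ws] form a connected set when [G] is generated
    by elements [g] such that [p] is linked to [act g p] by these translates. *)
Lemma span_edge_reps (p : T) (ws : seq (seq (set T * T))) :
  minimal_action T -> vert T p -> (forall s, s \in ws -> walk (vert T) (edge T) p s) ->
  (forall P : set G, P 1%g -> (forall g h, P g -> P h -> P (g / h)%g) ->
    (forall g s, s \in ws -> act g (last p (unzip2 s)) = last p (unzip2 s) -> P g) ->
    (forall g s, s \in ws -> act g p = last p (unzip2 s) -> P g) -> forall g, P g) ->
  edge_reps (flatten (map unzip1 ws)).
Proof.
move=> minT Vp wsw gen; set es := flatten _.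
have esE e : e \in es -> exists s, s \in ws /\ e \in unzip1 s.
  by move=> /flatten_mapP[s sws es']; exists s.
have es_edge e : e \in es -> edge T e.
  move=> /esE[s [/wsw ps /(walk_edge_ends ps)[a [b [[] //]]]]].
split=> //.
pose S : set T := [set x | (exists g, x = act g p) \/
  exists g e, e \in es /\ (act g @` e) x].
have Sact g z : S z -> S (act g z).
  case=> [[h ->]|[h [e [ees ez]]]]; first by left; exists (g * h)%g; rewrite act_mul.
  by right; exists (g * h)%g, e; split=> //; rewrite -act_imageM; apply/act_imageP.
have Sp : S p by left; exists 1%g; rewrite act_one.
have linkw s w : s \in ws -> w \in p :: unzip2 s -> connected_component S p w.
  move=> sws ws'; apply: (walk_linked (wsw s sws)) => // e es' x ex.
  right; exists 1%g, e; rewrite act_image1; split=> //.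
  by apply/flatten_mapP; exists s.
have linkg g : connected_component S p (act g p).
  move: g; apply: (gen [set g | connected_component S p (act g p)]) => /=.
  - by rewrite act_one; apply: connected_component_refl.
  - move=> g h pg ph; have := act_linked (Sact (g / h)%g) ph.
    rewrite -act_mul mulgVK => lk; apply: connected_component_trans pg _.
    exact: connected_component_sym.
  (* If [g] fixes the last vertex of a walk [s], then [s] links [p] to this vertex and the translate
     of [s] by [g] links it to [act g p]. *)
  - move=> g s sws gw; have := linkw s _ sws (mem_last _ _) => lk.
    apply: connected_component_trans lk _; rewrite -gw.
    exact: connected_component_sym (act_linked (Sact g) (linkw s _ sws (mem_last _ _))).
  - by move=> g s sws ->; apply: (linkw s) => //; apply: mem_last.
have ST : S = setT.
  apply: minT => //; first by exists p.
  rewrite -[S](_ : connected_component S p = _); first exact: component_connected.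
  apply/seteqP; split; first exact: connected_component_sub.
  move=> x [[g ->] //|[g [e [ees gex]]]].
  have [s [sws es']] := esE e ees.
  have [a [b [eab ina _]]] := walk_edge_ends (wsw s sws) es'.
  have [ea _ _ _] := ends_memP eab.
  apply: connected_component_trans (linkg g) _.
  apply: connected_component_trans (act_linked (Sact g) (linkw s a sws ina)) _.
  apply: (@edge_linked _ (act g @` e)) => //; first by apply/act_edge/es_edge.
  by move=> y ey; right; exists g, e.
(* An interior point of [e] is not in the orbit of the vertex [p], so it lies on a translate of a
   listed edge; this translate can only be [e]. *)
move=> e Ee; have [x [ex nVx]] := edge_interior Ee.
have : S x by rewrite ST.
case=> [[g xE]|[g [e0 [e0es e0x]]]]; first by case: nVx; rewrite xE; apply: act_vert.
exists e0, g; split=> //; apply: (@edge_unique _ _ _ _ x) => //.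
by apply/act_edge/es_edge.
Qed.

End GTree.

Arguments edge_reps {R G} T es.

(** The group is generated by the factors [Gs i], each fixing a vertex, and the [k] free generators.
    Finitely many walks from [v0] suffice: one to a fixed vertex of each factor, one to the image of
    [v0] under each generator. *)
Lemma outer_space_edge_reps (R : realType) (p k : nat)
    (Gs : 'I_p -> groupType) (F : groupType) (x : 'I_k -> F) (G : groupType)
    (iota : forall o, {multiplicative free_factor Gs F o -> G}) (T : gtree R G) :
  is_free_group x -> is_free_product iota -> in_outer_space iota T ->
  exists es : seq (set T), edge_reps T es.
Proof.
move=> hF hG [_ [minT _] C2 _].
have [v0 V0] := tree_nonempty T.
have walk_to w : vert T w ->
  exists s, walk (vert T) (edge T) v0 s /\ last v0 (unzip2 s) = w.
  by move=> Vw; have [s ? ?] := tree_connected V0 Vw; exists s.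
have walk_i i : exists s, walk (vert T) (edge T) v0 s /\
    forall g, act (iota (Some i) g) (last v0 (unzip2 s)) = last v0 (unzip2 s).
  have [v [[Vv [h stabv]] _]] := C2 i.
  (* The stabilizer of [v] is the conjugate by [h] of the image of [Gs i], so this image fixes the
     translate of [v] by the inverse of [h]. *)
  have [s [v0s sE]] := walk_to (act h^-1%g v) (act_vert _ Vv).
  exists s; split=> // g; rewrite sE -act_mul; apply: (@act_inj _ _ _ h).
  rewrite -!act_mul !mulgA mulgV act_one.
  have : stabilizer v (h * iota (Some i) g * h^-1)%g.
    by rewrite stabv; exists (iota (Some i) g) => //; exists g.
  by [].
have [wi wiP] := choice walk_i.
have walk_j j := walk_to (act (iota None (x j)) v0) (act_vert _ V0).
have [wj wjP] := choice walk_j.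
exists (flatten (map unzip1 ([seq wi i | i <- enum 'I_p] ++ [seq wj j | j <- enum 'I_k]))).
apply: (span_edge_reps minT V0) => [s|P P1 PF Pfix Pmove].
  by rewrite mem_cat => /orP[] /mapP[i _ ->]; [case: (wiP i)|case: (wjP i)].
apply: (free_factors_ind hF hG P1 PF) => [i g|j].
  apply: (Pfix _ (wi i)); last by case: (wiP i).
  by rewrite mem_cat map_f ?mem_enum.
apply: (Pmove _ (wj j)); last by case: (wjP j).
by rewrite mem_cat orbC map_f ?mem_enum.
Qed.

(** * Straight maps *)

Section PathLength.
Variables (R : realType) (X : metricType R).
Implicit Types (c : R -> X) (s t K : R).

Lemma path_length_ge c s t : s <= t -> ((mdist (c s) (c t))%:E <= path_length c s t)%E.
Proof.
rewrite le_eqVlt => /orP[/eqP ->|st]; apply: ereal_sup_ubound.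
  exists [::]; first by split=> /=.
  by rewrite seq_lengthE /= mdistxx.
exists [:: t]; first by split; rewrite /= ?st.
by rewrite seq_lengthE /= addr0.
Qed.

Lemma path_length_le c s t K :
  (forall u v, s <= u -> u <= v -> v <= t -> mdist (c u) (c v) <= K * (v - u)) ->
  (path_length c s t <= (K * (t - s))%:E)%E.
Proof.
move=> cK; apply: ge_ereal_sup => _ [r [sr /eqP rt] <-]; rewrite lee_fin seq_lengthE.
elim: r s sr rt cK => [|u r IHr] s /= sr rt cK; first by rewrite rt subrr mulr0.
case/andP: sr => su ur.
have ut : u <= t.
  rewrite -rt; elim: (r) (u) ur => [//|w r' IHr'] z /= /andP[zw wr].
  exact: le_trans (ltW zw) (IHr' _ wr).
have := IHr u ur rt (fun w v uw => cK w v (le_trans (ltW su) uw)).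
by have := cK s u (lexx _) (ltW su) ut; lra.
Qed.

End PathLength.

Section Between.
Variables (R : realType) (T : metric_tree R).
Implicit Types (p q x y : T).

(** This is the four-point condition for [x], [y], [p], [q], with [mdist p q] split at [x] or at
    [y]. It makes geodesics unique. *)
Lemma between_dist p q x y : mdist p x + mdist x q = mdist p q ->
  mdist p y + mdist y q = mdist p q -> mdist x y = `|mdist p x - mdist p y|.
Proof.
move=> xb yb; apply/eqP; rewrite eq_le; apply/andP; split; last first.
  rewrite ler_norml; have := metric_triangle p x y; have := metric_triangle p y x.
  by rewrite (metric_sym y x) => ? ?; apply/andP; split; lra.
have := ler_norm (mdist p x - mdist p y).
have := ler_norm (mdist p y - mdist p x); rewrite (distrC (mdist p y)).
have := tree_fourpoint x y p q.
rewrite (metric_sym x p) (metric_sym y p) => -[]; lra.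
Qed.

Lemma between_unique p q x y : mdist p x + mdist x q = mdist p q ->
  mdist p y + mdist y q = mdist p q -> mdist p x = mdist p y -> x = y.
Proof.
move=> xb yb pxy; apply: mdist_positivity.
by rewrite (between_dist xb yb) pxy subrr normr0.
Qed.

End Between.

Section LipschitzConstant.
Variables (R : realType) (G : groupType) (A B : gtree R G) (f : A -> B).

Lemma Lip_ge0 : 0 <= Lip f.
Proof.
have [[K fK]|e] := pselect (lipschitz_consts f !=set0).
  by apply: lb_le_inf => [|K' []]; first by exists K.
(* Without any Lipschitz constant, [Lip f] is the infimum of the empty set, which is [0] by
   convention. *)
rewrite /Lip (_ : lipschitz_consts f = set0) ?inf0 //.
by apply/seteqP; split=> // K fK; apply: e; exists K.
Qed.

Lemma Lip_lipschitz x y : lipschitz_consts f !=set0 ->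
  mdist (f x) (f y) <= Lip f * mdist x y.
Proof.
move=> [K fK]; have [->|/eqP xy] := pselect (x = y); first by rewrite !mdistxx mulr0.
have d0 : 0 < mdist x y by rewrite mdist_gt0.
rewrite -ler_pdivrMr //; apply: lb_le_inf; first by exists K.
by move=> K' [_ K'f]; rewrite ler_pdivrMr.
Qed.

Lemma Lip_le K : 0 <= K -> (forall x y, mdist (f x) (f y) <= K * mdist x y) ->
  Lip f <= K.
Proof. by move=> K0 fK; apply: ge_inf; [exists 0 => k []|split]. Qed.

Lemma constant_speed_ge e a b S : ends e a b -> constant_speed f e S ->
  mdist (f a) (f b) <= S * mdist a b.
Proof.
move=> eab [l [c [[l0 ciso cim cV] cS]]].
have i0 : 0 \in `[0, l] by rewrite in_itv /= lexx ltW.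
have il : l \in `[0, l] by rewrite in_itv /= lexx ltW.
have := @path_length_ge _ _ (f \o c) 0 l (ltW l0); rewrite cS ?lexx ?(ltW l0) // lee_fin.
have d0l : mdist (c 0) (c l) = l by rewrite ciso // sub0r normrN gtr0_norm.
rewrite /= subr0.
have [[-> ->]|[-> ->]] := eq_set2 (etrans (esym eab.2) cV); rewrite ?d0l //.
by rewrite metric_sym (metric_sym (c l)) d0l.
Qed.

Lemma constant_speed_le e S : edge A e -> lipschitz_consts f !=set0 ->
  constant_speed f e S -> S <= Lip f.
Proof.
move=> Ee fL [l [c [[l0 ciso cim cV] cS]]].
have := @path_length_le _ _ (f \o c) 0 l (Lip f).
rewrite cS ?lexx ?(ltW l0) // lee_fin subr0 ler_pM2r //; apply.
move=> u v u0 uv vl; apply: le_trans (Lip_lipschitz _ _ fL) _.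
rewrite ler_wpM2l ?Lip_ge0 // ciso ?in_itv /= ?u0 ?vl ?(le_trans uv) ?(le_trans u0) //.
by rewrite distrC ger0_norm // subr_ge0.
Qed.

End LipschitzConstant.

Section Straight.
Variables (R : realType) (G : groupType) (A B : gtree R G).
Implicit Types (f : A -> B) (e : set A).

Definition equivariant f : Prop := forall g x, f (act g x) = act g (f x).

(** Each edge is mapped proportionally to a geodesic; the products avoid dividing by [mdist a b] to
    form the speed. *)
Definition straight f : Prop := forall e a b x y, ends e a b -> e x -> e y ->
  mdist (f x) (f y) * mdist a b = mdist (f a) (f b) * mdist x y.

Lemma straight_constant_speed f e a b S : straight f -> ends e a b ->
  constant_speed f e S <-> mdist (f a) (f b) = S * mdist a b.
Proof.
move=> fs eab; have ab0 := ends_dist_gt0 eab.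
have len l c S' : edge_chart (vert A) e l c -> mdist (f a) (f b) = S' * mdist a b ->
    forall s t, 0 <= s -> s <= t -> t <= l -> path_length (f \o c) s t = (S' * (t - s))%:E.
  move=> [l0 ciso cim cV] fab s t s0 st tl.
  have fc u v : 0 <= u -> u <= v -> v <= l -> mdist (f (c u)) (f (c v)) = S' * (v - u).
    move=> u0 uv vl.
    have iu : u \in `[0, l] by rewrite in_itv /= u0 (le_trans uv).
    have iv : v \in `[0, l] by rewrite in_itv /= vl (le_trans u0).
    have eu : e (c u) by rewrite cim; exists u.
    have ev : e (c v) by rewrite cim; exists v.
    apply: (mulIf (lt0r_neq0 ab0)); rewrite (fs _ _ _ _ _ eab eu ev) fab ciso //.
    by rewrite distrC ger0_norm ?subr_ge0 // mulrAC.
  apply/eqP; rewrite eq_le; apply/andP; split.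
    apply: path_length_le => u v su uv vt; rewrite /= fc //.
      exact: le_trans su.
    exact: le_trans tl.
  by rewrite -(fc s t) //; apply: (@path_length_ge _ _ (f \o c)).
split=> [|fab].
  move=> [l [c [ch cS]]]; have := ch => -[l0 ciso cim cV].
  have fab : mdist (f a) (f b) = mdist (f a) (f b) / mdist a b * mdist a b.
    by rewrite mulfVK // lt0r_neq0.
  have := len l c _ ch fab 0 l (lexx _) (ltW l0) (lexx _).
  rewrite cS ?lexx ?(ltW l0) // subr0 => -[] /(mulIf (lt0r_neq0 l0)) ->.
  by rewrite -fab.
have [l [c [ch _ _]]] := ends_chart eab.
by exists l, c; split=> // s t s0 st tl; apply: (len l c).
Qed.

Lemma straight_lipschitz f K : straight f -> 0 <= K ->
  (forall e a b, ends e a b -> mdist (f a) (f b) <= K * mdist a b) ->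
  forall x y, mdist (f x) (f y) <= K * mdist x y.
Proof.
move=> fs K0 fK x y.
have step e z w : edge A e -> e z -> e w -> mdist (f z) (f w) <= K * mdist z w.
  move=> Ee ez ew; have [a [b eab]] := edge_ends Ee.
  rewrite -(ler_pM2r (ends_dist_gt0 eab)) (fs _ _ _ _ _ eab ez ew) mulrAC.
  by rewrite ler_wpM2r ?mdist_ge0 ?(fK e).
have along s : pl_path (edge A) x s ->
    mdist (f x) (f (last x s)) <= K * chain_length x s.
  elim: s x {y} => [|z s IHs] x /=; first by rewrite !mdistxx mulr0.
  move=> /andP[/asboolP[e Ee [ex ez]] zs].
  apply: le_trans (metric_triangle _ (f z) _) _.
  by rewrite mulrDr lerD ?IHs ?(step e).
have [s0 [xs0 sy0]] := pl_path_exists x y.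
(* For [K = 0] a single path gives the bound; otherwise [K] can be divided out before taking the
   infimum over paths. *)
have [KE|/eqP Kn0] := pselect (K = 0).
  by have := along _ xs0; rewrite sy0 KE !mul0r.
have Kp : 0 < K by rewrite lt_neqAle eq_sym Kn0.
rewrite mulrC -ler_pdivrMr // (tree_path_metric x y); apply: lb_le_inf.
  by exists (seq_length x s0), s0.
move=> _ [s [xs <-] <-]; rewrite seq_lengthE ler_pdivrMr // mulrC.
exact: along.
Qed.

Lemma equivariant_speed f es K : equivariant f -> edge_reps A es ->
  (forall e a b, e \in es -> ends e a b -> mdist (f a) (f b) <= K * mdist a b) ->
  forall e a b, ends e a b -> mdist (f a) (f b) <= K * mdist a b.
Proof.
move=> feq [_ cov] fK e a b eab; have [e0 [g [e0s eE]]] := cov e eab.1.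
have := act_ends g^-1%g eab; rewrite eE act_imageM mulVg act_image1 => e0ab.
by have := fK e0 _ _ e0s e0ab; rewrite !feq !act_isometry.
Qed.

Lemma straight_lipschitz_consts f es : equivariant f -> straight f -> edge_reps A es ->
  lipschitz_consts f !=set0.
Proof.
move=> feq fs reps.
suff [K [K0 fK]] : exists K, 0 <= K /\ forall e a b, e \in es -> ends e a b ->
    mdist (f a) (f b) <= K * mdist a b.
  by exists K; split=> //; apply: straight_lipschitz => //; apply: equivariant_speed reps fK.
elim: es {reps} => [|e es [K [K0 fK]]]; first by exists 0; split.
have [Ee|nEe] := pselect (edge A e); last first.
  exists K; split=> // e' a b; rewrite inE => /orP[/eqP -> [] //|]; exact: fK.
have [a [b eab]] := edge_ends Ee; have ab0 := ends_dist_gt0 eab.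
exists (Num.max K (mdist (f a) (f b) / mdist a b)); rewrite le_max K0; split=> //.
move=> e' a' b'; rewrite inE => /orP[/eqP -> eab'|/fK fK' /fK' h].
  have : mdist (f a) (f b) / mdist a b * mdist a' b' = mdist (f a') (f b').
    rewrite mulrAC -[RHS](mulfK (lt0r_neq0 (ends_dist_gt0 eab))).
    by have [? ? _ _] := ends_memP eab'; rewrite (fs _ _ _ _ _ eab).
  by move=> <-; rewrite ler_wpM2r ?mdist_ge0 // le_max lexx orbT.
by apply: le_trans h _; rewrite ler_wpM2r ?mdist_ge0 // le_max lexx.
Qed.

(** The image is nonempty, connected and invariant, so minimality of [B] makes it everything. *)
Lemma equivariant_surjective f : equivariant f -> lipschitz_consts f !=set0 ->
  minimal_action B -> forall y, exists x, f x = y.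
Proof.
move=> feq [K [K0 fK]] minB y.
have -> : (exists x, f x = y) = (range f) y.
  by apply/propext; split=> [[x <-]|[x _ <-]]; exists x.
rewrite (minB (range f)) //.
- by have [p _] := tree_nonempty A; exists (f p), p.
- apply: connected_continuous_connected; first exact: tree_setT_connected.
  exact/continuous_subspaceT/(lipschitz_continuous fK).
- by move=> g _ [x _ <-]; exists (act g x); rewrite ?feq.
Qed.

Lemma straight_PL_map f es : equivariant f -> straight f -> edge_reps A es ->
  minimal_action B -> PL_map f.
Proof.
move=> feq fs reps minB; have fL := straight_lipschitz_consts feq fs reps.
split; first by split=> //; apply: equivariant_surjective.
move=> e Ee; have [a [b eab]] := edge_ends Ee; have ab0 := ends_dist_gt0 eab.
exists (mdist (f a) (f b) / mdist a b); split.
- by rewrite divr_ge0 ?mdist_ge0.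
- by apply/(straight_constant_speed _ fs eab); rewrite mulfVK // lt0r_neq0.
- rewrite pmulr_lgt0 ?invr_gt0 // => fab x ex; exists setT; first exact: filterT.
  move=> y z [_ ey] [_ ez] fyz; have := fs _ _ _ _ _ eab ey ez.
  rewrite fyz mdistxx mul0r => /esym/eqP; rewrite mulf_eq0 (gt_eqF fab) => /eqP.
  exact: mdist_positivity.
Qed.

Lemma straight_A_max f e a b : straight f -> ends e a b ->
  A_max f e <-> mdist (f a) (f b) = Lip f * mdist a b.
Proof.
move=> fs eab; split=> [[_ /(straight_constant_speed _ fs eab)] //|h].
by split; [case: eab|apply/(straight_constant_speed _ fs eab)].
Qed.

Lemma straighten (f0 : A -> B) :
  (forall g v, vert A v -> f0 (act g v) = act g (f0 v)) ->
  exists f, [/\ equivariant f, straight f & forall v, vert A v -> f v = f0 v].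
Proof.
move=> f0eq.
(* [Q x y] places [y] on the geodesic between the images of the ends in the proportion of [x] on its
   edge, for both orders of the ends. It determines [y] when [x] is not a vertex, so a map chosen to
   satisfy it is automatically equivariant there. *)
pose Q x y := forall e a b, ends e a b -> e x ->
  mdist (f0 a) y * mdist a b = mdist (f0 a) (f0 b) * mdist a x.
have Q_between x y e a b : Q x y -> ends e a b -> e x ->
    mdist (f0 a) y + mdist y (f0 b) = mdist (f0 a) (f0 b).
  move=> Qxy eab ex; have ab0 := ends_dist_gt0 eab.
  have h1 := Qxy _ _ _ eab ex; have h2 := Qxy _ _ _ (ends_sym eab) ex.
  apply: (mulIf (lt0r_neq0 ab0)).
  rewrite mulrDl h1 [mdist y _]metric_sym (metric_sym a b) h2.
  rewrite (metric_sym (f0 b)) -mulrDr; congr (_ * _).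
  by rewrite (metric_sym b x) (metric_sym b a); apply: edge_dist_ends ex.
have Q_unique x y y' : ~ vert A x -> Q x y -> Q x y' -> y = y'.
  move=> nVx Qy Qy'; have [//|[e Ee ex]] := cover_point x.
  have [a [b eab]] := edge_ends Ee; have ab0 := ends_dist_gt0 eab.
  apply: (between_unique (Q_between _ _ _ _ _ Qy eab ex) (Q_between _ _ _ _ _ Qy' eab ex)).
  by apply: (mulIf (lt0r_neq0 ab0)); rewrite (Qy _ _ _ eab ex) (Qy' _ _ _ eab ex).
have Q_vert v : vert A v -> Q v (f0 v).
  move=> Vv e a b eab ev; have [->|->] := ends_vert eab Vv ev => //.
  by rewrite !mdistxx mulr0 mul0r.
have Q_exists x : exists y, Q x y /\ (vert A x -> y = f0 x).
  have [Vx|nVx] := pselect (vert A x); first by exists (f0 x); split=> //; apply: Q_vert.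
  have [//|[e Ee ex]] := cover_point x.
  have [a [b eab]] := edge_ends Ee; have ab0 := ends_dist_gt0 eab.
  have axb := edge_dist_ends eab ex.
  pose t := mdist (f0 a) (f0 b) * mdist a x / mdist a b.
  have [|y [ay yb]] := @tree_geodesic _ _ (f0 a) (f0 b) t.
    rewrite /t -mulrA mulr_ge0 ?divr_ge0 ?mdist_ge0 //=.
    rewrite ler_piMr ?mdist_ge0 // ler_pdivrMr // mul1r -axb lerDl mdist_ge0 //.
  exists y; split=> // e' a' b' eab' ex'.
  have ee : e' = e by apply: (edge_unique eab'.1 Ee ex' ex).
  have tE : t * mdist a b = mdist (f0 a) (f0 b) * mdist a x.
    by rewrite /t mulfVK // lt0r_neq0.
  rewrite ee in eab'; have [[-> ->]|[-> ->]] := eq_set2 (etrans (esym eab'.2) eab.2).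
    by rewrite ay.
  rewrite metric_sym yb (metric_sym b a) (metric_sym (f0 b)) mulrBl tE -mulrBr.
  by congr (_ * _); rewrite -axb (metric_sym b x) addrC addKr.
have [f fQ] := choice Q_exists.
have fV v : vert A v -> f v = f0 v by move=> Vv; apply: (fQ v).2.
exists f; split=> //.
- move=> g x; have [Vx|nVx] := pselect (vert A x).
    by rewrite !fV ?f0eq //; apply: act_vert.
  have nVgx : ~ vert A (act g x) by rewrite act_vertE.
  apply: (Q_unique (act g x)) => //; first exact: (fQ _).1.
  move=> e a b eab egx.
  have eab' := act_ends g^-1%g eab.
  have ex : (act g^-1%g @` e) x by exists (act g x) => //; rewrite actK.
  have [ea eb Va Vb] := ends_memP eab'.
  have := (fQ x).1 _ _ _ eab' ex.
  rewrite act_isometry !f0eq; [|by case: (ends_memP eab)..].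
  rewrite act_isometry -(act_isometry g (act _ (f0 a))) -(act_isometry g (act _ a)).
  by rewrite !actVK.
- move=> e a b x y eab ex ey; have [_ _ Va Vb] := ends_memP eab.
  have bx := Q_between _ _ _ _ _ (fQ x).1 eab ex.
  have by' := Q_between _ _ _ _ _ (fQ y).1 eab ey.
  rewrite (fV a Va) (fV b Vb) (between_dist bx by') (edge_dist eab ex ey).
  rewrite -{1}(ger0_norm (mdist_ge0 a b)) -normrM mulrBl.
  rewrite ((fQ x).1 _ _ _ eab ex) ((fQ y).1 _ _ _ eab ey) -mulrBr normrM.
  by rewrite (ger0_norm (mdist_ge0 _ _)).
Qed.

End Straight.

(** * Germs *)

Section Rigidity.
Variables (R : realType) (G : groupType) (T : gtree R G).
Hypothesis trivT : trivial_edge_stabilizers T.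

(* [g] fixes the geodesic from [p] to [q], which contains an interior point of an
   edge. *)
Lemma fix_two_points g (p q : T) : act g p = p -> act g q = q -> p <> q -> g = 1%g.
Proof.
move=> gp gq pq.
have [Vp|nVp] := pselect (vert T p); last exact: stabilizer_interior gp.
have [Vq|nVq] := pselect (vert T q); last exact: stabilizer_interior gq.
have [[|[e w] s] [ps sq pqE]] := vert_dist_walk Vp Vq; first by case: pq.
have [epw ws] := (walk_cons _ _ _ _).1 ps.
have [x [ex nVx]] := edge_interior epw.1.
apply: (stabilizer_interior trivT nVx).
have len_ge (r : seq T) z : mdist z (last z r) <= chain_length z r.
  elim: r z => [|u r IHr] z /=; first by rewrite mdistxx.
  by apply: le_trans (metric_triangle z u _) _; rewrite lerD2l.
have xb : mdist p x + mdist x q = mdist p q.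
  apply/eqP; rewrite eq_le metric_triangle andbT.
  have := len_ge (unzip2 s) w; move: sq pqE => /= -> ->.
  have := edge_dist_ends epw ex; have := metric_triangle x w q; lra.
have px : mdist p (act g x) = mdist p x by rewrite -{1}gp act_isometry.
have xq : mdist (act g x) q = mdist x q by rewrite -{1}gq act_isometry.
by apply: (@between_unique _ _ p q); rewrite ?px ?xq.
Qed.

End Rigidity.

Section EquivariantChoice.
Variables (R : realType) (G : groupType) (A B : gtree R G).

(** An image is chosen at one representative of each orbit and translated. It is fixed by the
    stabilizer of the representative, so the result does not depend on the translating element. *)
Lemma equivariant_choice (P : A -> B -> Prop) :
  (forall g x y, P x y -> P (act g x) (act g y)) ->
  (forall x, vert A x -> exists y, P x y /\ forall g, act g x = x -> act g y = y) ->
  exists phi : A -> B,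
    (forall g v, vert A v -> phi (act g v) = act g (phi v)) /\
    (forall v, vert A v -> P v (phi v)).
Proof.
move=> Pact Pex; have [p Vp] := tree_nonempty A.
pose orbit (x : A) : set A := [set y | exists g, y = act g x].
pose rep x := xget p (orbit x).
have orbit_act g x : orbit (act g x) = orbit x.
  apply/seteqP; split=> y [h ->]; first by exists (h * g)%g; rewrite act_mul.
  by exists (h * g^-1)%g; rewrite act_mul actK.
have rep_ex x : exists g, x = act g (rep x).
  have : orbit x (rep x) by apply: xgetPex; exists x; exists 1%g; rewrite act_one.
  by move=> [g ->]; exists g^-1%g; rewrite actK.
have [gam gamE] := choice rep_ex.
have psi_ex (x : A) : exists y : B, vert A x ->
    P x y /\ forall g, act g x = x -> act g y = y.
  have [Vx|nVx] := pselect (vert A x); first by have [y ?] := Pex x Vx; exists y.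
  by have [y _] := Pex p Vp; exists y.
have [psi psiP] := choice psi_ex.
have Vrep x : vert A x -> vert A (rep x) by rewrite {1}(gamE x) act_vertE.
exists (fun x => act (gam x) (psi (rep x))); split=> [g v Vv|v Vv]; last first.
  by rewrite {1}(gamE v); apply: Pact; apply: (psiP _ (Vrep v Vv)).1.
have repE : rep (act g v) = rep v by rewrite /rep orbit_act.
rewrite repE -act_mul; apply: (@act_inj _ _ _ (g * gam v)^-1%g).
rewrite actK -act_mul; apply: (psiP _ (Vrep v Vv)).2.
rewrite act_mul -repE -gamE repE; apply: (@act_inj _ _ _ (g * gam v)%g).
by rewrite actVK act_mul -gamE.
Qed.

End EquivariantChoice.

Section Germs.
Variables (R : realType) (G : groupType) (A B : gtree R G) (f : A -> B).
Implicit Types (e : set A) (v w : A).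

Lemma germ_equiv_sym v e e' : germ_equiv f v e e' -> germ_equiv f v e' e.
Proof. by case=> [->|[? ? ?]]; [left|right]. Qed.

Lemma germ_equiv_trans v e1 e2 e3 :
  germ_equiv f v e1 e2 -> germ_equiv f v e2 e3 -> germ_equiv f v e1 e3.
Proof.
case=> [-> //|[n1 n2 e12]] [<-|[_ n3 e23]]; right => //.
by split; rewrite // e12.
Qed.

Lemma not_optimal_atP v : not_optimal_at f v <->
  exists2 e0, (A_max f `&` edges_at v) e0 &
    forall e, (A_max f `&` edges_at v) e -> germ_equiv f v e e0.
Proof.
have gateE e : (A_max f `&` edges_at v) e -> gate f v e e by move=> [_ ?]; split=> //; left.
split=> [[C gC]|[e0 me0 all0]].
  have [e0 me0 e0C] : A_max_gates f v C by rewrite gC.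
  subst C; exists e0 => // e me.
  have : A_max_gates f v (gate f v e) by exists e.
  rewrite gC => /= ge; have := gateE _ me0; rewrite -ge.
  by case.
exists (gate f v e0); apply/seteqP; split=> [_ [e me <-]|_ ->]; last by exists e0.
apply/seteqP; split=> e' [e'v h]; split=> //.
  by apply: germ_equiv_trans (germ_equiv_sym (all0 e me)) h.
exact: germ_equiv_trans (all0 e me) h.
Qed.

Hypothesis fs : straight f.

Lemma straight_between e a b x : ends e a b -> e x ->
  mdist (f a) (f x) + mdist (f x) (f b) = mdist (f a) (f b).
Proof.
move=> eab ex; have [ea eb _ _] := ends_memP eab.
apply: (mulIf (lt0r_neq0 (ends_dist_gt0 eab))).
rewrite mulrDl (fs eab ea ex) (fs eab ex eb) -mulrDr; congr (_ * _).
exact: edge_dist_ends eab ex.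
Qed.

(** Equal germs make the images of [e'] and [e] share an initial segment: a point at distance less
    than [tau] from [f v] on the geodesic to [f w] is also on the geodesic to [f w']. *)
Lemma germ_initial e e' v w w' : ends e v w -> ends e' v w' ->
  0 < mdist (f v) (f w') -> germ_equiv f v e' e ->
  exists2 tau, 0 < tau & forall t y, 0 <= t < tau -> mdist (f v) y = t ->
    mdist y (f w) = mdist (f v) (f w) - t ->
    t < mdist (f v) (f w') /\ mdist y (f w') = mdist (f v) (f w') - t.
Proof.
move=> evw evw' fvw' [ee|[_ _ eq_germ]].
  subst e'; have -> : w' = w.
    have [_ ew' _ Vw'] := ends_memP evw'.
    by have [wv|//] := ends_vert evw Vw' ew'; case: (ends_neq evw').
  exists (mdist (f v) (f w)); last by move=> t y /andP[_ ?] _ ->.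
  have [_ ew' _ Vw'] := ends_memP evw'; have [wv|<- //] := ends_vert evw Vw' ew'.
  by case: (ends_neq evw').
have : germ_image f v e' (f @` e).
  rewrite eq_germ /germ_image /= /nbhs /= /within /=.
  by apply: filterE => x ex; exists x.
rewrite /germ_image /= => /metricType_numDomainType.nbhs_mdistP[eps /= eps0 epsP].
have vw0 := ends_dist_gt0 evw'.
(* [S] is the speed of [f] on [e']. Within distance [eps] of [v] the image of [e'] is contained in
   that of [e], which gives a common segment of length [S * eps] unless [e'] ends before. *)
pose S := mdist (f v) (f w') / mdist v w'.
have S0 : 0 < S by rewrite divr_gt0.
exists (Num.min (S * eps) (mdist (f v) (f w'))); first by rewrite lt_min mulr_gt0.
move=> t y /andP[t0]; rewrite lt_min => /andP[tS tD] yt yw; split=> //.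
have [|x [ex vx]] := @edge_point _ _ e' v w' (t / S) evw'.
  rewrite divr_ge0 ?(ltW S0) //= ler_pdivrMr // mulrC /S mulfVK ?lt0r_neq0 //.
  exact: ltW.
have fvx : mdist (f v) (f x) = t.
  apply: (mulIf (lt0r_neq0 vw0)); have [ev' _ _ _] := ends_memP evw'.
  by rewrite (fs evw' ev' ex) vx /S; field; rewrite !lt0r_neq0.
have [|x' ex' fx'] := epsP x _ ex.
  by rewrite /= vx ltr_pdivrMr // mulrC.
have -> : y = f x.
  apply: (@between_unique _ _ (f v) (f w)); last by rewrite yt fvx.
    by rewrite yt yw addrC subrK.
  by rewrite -fx'; apply: straight_between evw ex'.
by rewrite -(straight_between evw' ex) fvx addrC addKr.
Qed.

End Germs.

(** * The descent step *)

(** The minimum over the list works; this chooses one small constant for finitely many edges or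
    lengths at once. *)
Lemma common_radius (R : realType) (I : eqType) (l : seq I) (P : I -> R -> Prop) :
  (forall i s t, P i t -> s <= t -> P i s) ->
  (forall i, i \in l -> exists2 t, 0 < t & P i t) ->
  exists2 t, 0 < t & forall i, i \in l -> P i t.
Proof.
move=> Pdown; elim: l => [|i l IHl] Pl; first by exists 1.
have [|t t0 Pt] := IHl; first by move=> j jl; apply: Pl; rewrite inE jl orbT.
have [|s s0 Ps] := Pl i; first by rewrite inE eqxx.
exists (Num.min s t); first by rewrite lt_min s0.
move=> j; rewrite inE => /orP[/eqP ->|/Pt Pj].
  by apply: Pdown Ps _; rewrite ge_min lexx.
by apply: Pdown Pj _; rewrite ge_min lexx orbT.
Qed.

Section Descent.
Variables (R : realType) (G : groupType) (A B : gtree R G) (es : seq (set A)).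
Hypothesis reps : edge_reps A es.
Hypothesis trivB : trivial_edge_stabilizers B.
Variable f : A -> B.
Hypothesis feq : equivariant f.
Hypothesis fs : straight f.
Implicit Types (e : set A) (a b v w : A) (g h : G).

Lemma A_max_act g e : A_max f (act g @` e) <-> A_max f e.
Proof.
have imp h e' : A_max f e' -> A_max f (act h @` e').
  move=> me; have [a [b eab]] := edge_ends me.1.
  have := (straight_A_max fs eab).1 me.
  by move=> fab; apply/(straight_A_max fs (act_ends h eab)); rewrite !feq !act_isometry.
by split=> [/(imp g^-1%g)|]; [rewrite act_imageM mulVg act_image1|apply: imp].
Qed.

(** Finite valence at a vertex with trivial stabilizer: at most one group element carries a given
    end of a representative edge to [v], so each representative contributes at most two edges there.
    A point that is not a vertex lies on at most one edge. *)
Lemma free_edges_at v : (forall g, act g v = v -> g = 1%g) ->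
  exists l : seq (set A), forall e, edges_at v e -> e \in l.
Proof.
move=> free.
have transl a : exists h, forall g, act g a = v -> g = h.
  have [[h ha]|nh] := pselect (exists h, act h a = v); last first.
    by exists 1%g => g ga; case: nh; exists g.
  exists h => g ga; suff : (g / h = 1)%g by move/divg1_eq.
  by apply: free; rewrite act_mul -{1}ha actK.
have [hs hsP] := choice transl.
have near e : exists l : seq (set A), forall g, (act g @` e) v -> edge A e ->
    vert A v -> act g @` e \in l.
  have [Ee|nEe] := pselect (edge A e); last by exists [::].
  have [a [b eab]] := edge_ends Ee.
  exists [:: act (hs a) @` e; act (hs b) @` e] => g gev _ Vv; rewrite !inE.
  have [va|vb] := ends_vert (act_ends g eab) Vv gev.
    by rewrite -(hsP a g) ?eqxx.
  by rewrite -(hsP b g) ?eqxx ?orbT.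
have [ls lsP] := choice near.
have [Vv|nVv] := pselect (vert A v); last first.
  have [[e0 Ee0v]|ne] := pselect (exists e0, edges_at v e0); last first.
    by exists [::] => e Ee; case: ne; exists e.
  exists [:: e0] => e Ee; rewrite inE; apply/eqP.
  exact: edge_unique Ee.1 Ee0v.1 Ee.2 Ee0v.2 nVv.
exists (flatten (map ls es)) => e [Ee ev].
have [e0 [g [e0es eE]]] := reps.2 e Ee; rewrite eE.
apply/flatten_mapP; exists e0 => //; apply: lsP => //; first by rewrite -eE.
exact: reps.1.
Qed.

Section OneGate.
Variables (v w0 : A) (e0 : set A).
Hypothesis ve0 : ends e0 v w0.
Hypothesis me0 : A_max f e0.
Hypothesis L0 : 0 < Lip f.
Hypothesis gate_v : forall e, (A_max f `&` edges_at v) e -> germ_equiv f v e e0.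

Let A_max_dist e a b : A_max f e -> ends e a b -> mdist (f a) (f b) = Lip f * mdist a b.
Proof. by move=> me eab; apply: (straight_A_max fs eab).1. Qed.

Let A_max_gt0 e a b : A_max f e -> ends e a b -> 0 < mdist (f a) (f b).
Proof.
by move=> me eab; rewrite (A_max_dist me eab) mulr_gt0 // (ends_dist_gt0 eab).
Qed.

Let germ_v e w : A_max f e -> ends e v w -> germ_equiv f v e e0.
Proof.
move=> me evw; apply: gate_v; split=> //; split; first by case: evw.
by case: (ends_memP evw).
Qed.

(** The edges [e0] and its translate by [g] are both maximal at [v], so their images share an
    initial segment. As [g] fixes [f v] and maps one image to the other, it fixes a further point
    [y] of this segment. *)
Lemma one_gate_free g : act g v = v -> g = 1%g.
Proof.
move=> gv.
have ge0 := act_ends g ve0; rewrite gv in ge0.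
have mge0 : A_max f (act g @` e0) by apply/A_max_act.
have [tau tau0 tauP] := germ_initial fs ve0 ge0 (A_max_gt0 mge0 ge0) (germ_v mge0 ge0).
have D0 := A_max_gt0 me0 ve0.
pose t := Num.min tau (mdist (f v) (f w0)) / 2.
have t0 : 0 < t by rewrite divr_gt0 // lt_min tau0.
have ttau : t < tau.
  have : Num.min tau (mdist (f v) (f w0)) <= tau by rewrite ge_min lexx.
  by rewrite /t; lra.
have tD : t <= mdist (f v) (f w0).
  have : Num.min tau (mdist (f v) (f w0)) <= mdist (f v) (f w0) by rewrite ge_min lexx orbT.
  by move: D0; rewrite /t; lra.
have [|y [vy yw]] := @tree_geodesic _ _ (f v) (f w0) t; first by rewrite (ltW t0).
have [|tD' yw'] := tauP t y _ vy yw; first by rewrite (ltW t0).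
have gfv : act g (f v) = f v by rewrite -feq gv.
have vgy : mdist (f v) (act g y) = t by rewrite -{1}gfv act_isometry.
apply: (fix_two_points trivB gfv (q := y)); last first.
  by move=> vyE; move: t0; rewrite -vy vyE mdistxx ltxx.
apply: (@between_unique _ _ (f v) (f (act g w0))); last by rewrite vgy vy.
  rewrite vgy feq act_isometry yw -{2}gfv act_isometry; lra.
by rewrite vy yw'; lra.
Qed.

Lemma descent : lipschitz_consts f !=set0 -> exists f' : A -> B,
  [/\ equivariant f', straight f', Lip f' <= Lip f
    & Lip f' = Lip f -> A_max f' `<` A_max f].
Proof.
move=> fL; have [_ _ Vv Vw0] := ends_memP ve0.
have D0 := A_max_gt0 me0 ve0.
have [l lP] := free_edges_at one_gate_free.
(* Up to length [tau1] the images of all the maximally stretched edges at [v] coincide with that of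
   [e0]. *)
have [tau1 tau10 tau1P] : exists2 tau, 0 < tau & forall e, e \in l -> forall w,
    A_max f e -> ends e v w -> forall t y, 0 <= t < tau -> mdist (f v) y = t ->
    mdist y (f w0) = mdist (f v) (f w0) - t ->
    t < mdist (f v) (f w) /\ mdist y (f w) = mdist (f v) (f w) - t.
  apply: common_radius => [e s t Pt st w me evw t' y /andP[t0 t's]|e _].
    by apply: Pt me evw _ _ _; rewrite t0 (lt_le_trans t's).
  have [[w [me evw]]|nw] := pselect (exists w, A_max f e /\ ends e v w); last first.
    by exists 1 => // w me evw; case: nw; exists w.
  have [tau tau0 tauP] := germ_initial fs ve0 evw (A_max_gt0 me evw) (germ_v me evw).
  exists tau => // w' me' evw'; have <- // : w = w'.
  have [_ ew _ Vw] := ends_memP evw.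
  by have [wv|//] := ends_vert evw' Vw ew; case: (ends_neq evw).
(* [tau2] measures the slack of the edges outside [A_max f]; the factor 2 allows both ends to
   move. *)
have [tau2 tau20 tau2P] : exists2 tau, 0 < tau & forall e, e \in es ->
    forall a b, ends e a b -> ~ A_max f e ->
    mdist (f a) (f b) + 2 * tau <= Lip f * mdist a b.
  apply: common_radius => [e s t Pt st a b eab nme|e ees].
    by have := Pt a b eab nme; lra.
  have [me|nme] := pselect (A_max f e); first by exists 1.
  have [a [b eab]] := edge_ends (reps.1 e ees).
  have lt_ab : mdist (f a) (f b) < Lip f * mdist a b.
    rewrite lt_neqAle Lip_lipschitz // andbT; apply/eqP => fab.
    by apply: nme; apply/(straight_A_max fs eab).
  exists ((Lip f * mdist a b - mdist (f a) (f b)) / 2); first by lra.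
  move=> a' b' eab' _.
  have [[-> ->]|[-> ->]] := eq_set2 (etrans (esym eab'.2) eab.2); first by lra.
  by rewrite (metric_sym b) (metric_sym (f b)); lra.
pose t := Num.min (Num.min tau1 tau2) (mdist (f v) (f w0)) / 2.
have [t0 tD tt1 tt2] : [/\ 0 < t, t < mdist (f v) (f w0), t < tau1 & t < tau2].
  have h1 : Num.min (Num.min tau1 tau2) (mdist (f v) (f w0)) <= mdist (f v) (f w0).
    by rewrite ge_min lexx orbT.
  have h2 : Num.min (Num.min tau1 tau2) (mdist (f v) (f w0)) <= tau1.
    by rewrite !ge_min lexx.
  have h3 : Num.min (Num.min tau1 tau2) (mdist (f v) (f w0)) <= tau2.
    by rewrite !ge_min lexx orbT.
  have h4 : 0 < Num.min (Num.min tau1 tau2) (mdist (f v) (f w0)) by rewrite !lt_min tau10 tau20.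
  by rewrite /t; split; lra.
have [|u [vu uw0]] := @tree_geodesic _ _ (f v) (f w0) t; first by rewrite !ltW.
have u_dist e w : A_max f e -> ends e v w ->
    t < mdist (f v) (f w) /\ mdist u (f w) = mdist (f v) (f w) - t.
  move=> me evw; apply: (tau1P e) => //; last by rewrite (ltW t0).
  by apply: lP; split; [case: evw|case: (ends_memP evw)].
(* The orbit of [v] is sent to that of [u]; all other vertices keep their images. *)
pose P (x : A) (y : B) := (forall g, x = act g v -> y = act g u) /\
  ((forall g, x <> act g v) -> y = f x).
have [phi [phi_eq phiP]] : exists phi : A -> B,
    (forall g x, vert A x -> phi (act g x) = act g (phi x)) /\
    (forall x, vert A x -> P x (phi x)).
  apply: equivariant_choice => [g x y [Py1 Py2]|x Vx].
    split=> [h gx|ngx].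
      rewrite (Py1 (g^-1 * h)%g) ?act_mul ?actVK //.
      by rewrite -gx actK.
    rewrite Py2 ?feq // => h xE; apply: (ngx (g * h)%g).
    by rewrite act_mul xE.
  have [[g xE]|nx] := pselect (exists g, x = act g v).
    (* The point [x] determines [g] because [v] has trivial stabilizer, so this image is unambiguous
       and has the invariance required. *)
    exists (act g u); split.
      split=> [h|/(_ g) //]; rewrite xE => ghv.
      suff -> : h = g by [].
      rewrite -(mulVKg g h) (_ : (g^-1 * h)%g = 1%g) ?mulg1 //.
      by apply: one_gate_free; rewrite act_mul -ghv actK.
    move=> h; rewrite xE -!act_mul => hgv.
    suff -> : (h * g)%g = g by [].
    rewrite -(mulVKg g (h * g)%g) (_ : (g^-1 * (h * g))%g = 1%g) ?mulg1 //.
    by apply: one_gate_free; rewrite act_mul hgv actK.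
  exists (f x); split.
    by split=> // g xE; case: nx; exists g.
  by move=> g gx; rewrite -feq gx.
have [f' [f'eq f's f'V]] := straighten phi_eq.
have f'_orbit g : f' (act g v) = act g u.
  by rewrite f'V; [apply: (phiP _ _).1 => //|]; apply: act_vert.
have f'_other x : vert A x -> (forall g, x <> act g v) -> f' x = f x.
  by move=> Vx nx; rewrite f'V //; apply: (phiP _ _).2.
have moved x : vert A x -> mdist (f' x) (f x) <= t.
  move=> Vx; have [[g ->]|nx] := pselect (exists g, x = act g v).
    by rewrite f'_orbit feq act_isometry metric_sym vu.
  rewrite f'_other ?mdistxx ?(ltW t0) // => g xE; case: nx; by exists g.
have not_max e a b : ends e a b -> ~ A_max f e -> mdist (f' a) (f' b) < Lip f * mdist a b.
  move=> eab nme; have [e1 [g [e1es eE]]] := reps.2 e eab.1.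
  have eab1 : ends e1 (act g^-1%g a) (act g^-1%g b).
    by have := act_ends g^-1%g eab; rewrite eE act_imageM mulVg act_image1.
  have nme1 : ~ A_max f e1 by rewrite eE A_max_act in nme.
  have := tau2P e1 e1es _ _ eab1 nme1; rewrite !feq !act_isometry.
  have [_ _ Va Vb] := ends_memP eab.
  have := moved a Va; have := moved b Vb.
  have := metric_triangle (f' a) (f a) (f' b); have := metric_triangle (f a) (f b) (f' b).
  by rewrite (metric_sym (f b) (f' b)); lra.
(* If both ends of the edge are in the orbit of [v], they move towards each other,
   which shortens the image from [D] to [`|D - 2 * t|]. *)
have toward e w : A_max f e -> ends e v w -> mdist (f' v) (f' w) < mdist (f v) (f w).
  move=> me evw; have [tDw uw] := u_dist e w me evw.
  have f'v : f' v = u by have := f'_orbit 1%g; rewrite !act_one.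
  have [_ _ _ Vw] := ends_memP evw.
  rewrite f'v; have [[h wE]|nw] := pselect (exists h, w = act h v); last first.
    by rewrite f'_other ?uw; [lra|by []|move=> g wE; case: nw; exists g].
  have he : ends (act h^-1%g @` e) v (act h^-1%g v).
    by apply: ends_sym; have := act_ends h^-1%g evw; rewrite wE actK.
  have [|_] := u_dist _ _ _ he; first exact/A_max_act.
  rewrite feq -(act_isometry h u) actVK -(act_isometry h (f v)) actVK -feq -wE => huv.
  have whu : mdist (f w) (act h u) = t by rewrite wE feq act_isometry vu.
  rewrite wE f'_orbit (@between_dist _ _ (f v) (f w)).
  - rewrite vu (metric_sym (f v)) huv (metric_sym (f w)) -wE ltr_norml.
    by apply/andP; split; lra.
  - by rewrite vu uw; lra.
  - by rewrite (metric_sym (f v)) huv (metric_sym _ (f w)) whu (metric_sym (f w)); lra.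
have max_orbit e g w : A_max f e -> ends e (act g v) w ->
    mdist (f' (act g v)) (f' w) < mdist (f (act g v)) (f w).
  move=> me egw; have := act_ends g^-1%g egw; rewrite actK => evw.
  have := toward _ _ ((A_max_act _ _).2 me) evw.
  by rewrite -(act_isometry g) -!f'eq actVK -(act_isometry g (f v)) -!feq actVK.
have le_max e a b : ends e a b -> mdist (f' a) (f' b) <= Lip f * mdist a b.
  move=> eab; have [me|nme] := pselect (A_max f e); last exact: ltW (not_max _ _ _ eab nme).
  rewrite -(A_max_dist me eab); have [_ _ Va Vb] := ends_memP eab.
  have [[g aE]|na] := pselect (exists g, a = act g v).
    by subst a; apply/ltW/(max_orbit e).
  have [[g bE]|nb] := pselect (exists g, b = act g v).
    subst b; rewrite metric_sym (metric_sym (f a)).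
    by apply/ltW/(max_orbit e) => //; apply: ends_sym.
  by rewrite !f'_other // => g xE; [case: nb|case: na]; exists g.
have Lf' : Lip f' <= Lip f.
  by apply: Lip_le; rewrite ?ltW //; apply: straight_lipschitz => //; apply: ltW.
(* If the Lipschitz constant is unchanged, no edge outside [A_max f] reaches it, and [e0], whose
   image got shorter, no longer does. *)
exists f'; split=> // LE; split=> [|sub].
  move=> e me'; apply: contrapT => nme; have [a [b eab]] := edge_ends me'.1.
  by have := not_max _ _ _ eab nme; rewrite -LE ((straight_A_max f's eab).1 me') ltxx.
have := (straight_A_max f's ve0).1 (sub _ me0); rewrite LE => fE.
by have := toward _ _ me0 ve0; rewrite fE (A_max_dist me0 ve0) ltxx.
Qed.

End OneGate.
End Descent.

(** * Iteration of the descent *)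

Section Optimize.
Variables (R : realType) (G : groupType) (A B : gtree R G) (es : seq (set A)).
Hypothesis reps : edge_reps A es.
Hypothesis trivB : trivial_edge_stabilizers B.
Hypothesis minB : minimal_action B.
Hypothesis Lip_gt0 : forall f : A -> B, O_map f -> edge A !=set0 -> 0 < Lip f.
Implicit Types (f h : A -> B) (e : set A) (a b v w : A).

Definition Lip_minimal f : Prop := forall f', O_map f' -> Lip f <= Lip f'.

Let PL f : equivariant f -> straight f -> PL_map f.
Proof. by move=> feq fs; apply: straight_PL_map reps minB. Qed.

Let count_lt (T : eqType) (P Q : pred T) (s : seq T) x : subpred P Q ->
  x \in s -> Q x -> ~~ P x -> (count P s < count Q s)%N.
Proof.
move=> PQ + Qx nPx; elim: s => [//|y s IHs]; rewrite inE => /orP[/eqP <-|/IHs lt] /=.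
  by rewrite Qx (negPf nPx) /= add0n add1n ltnS sub_count.
rewrite -addnS leq_add //; case Py: (P y) => //; by rewrite (PQ _ Py).
Qed.

(** Induction on the number of listed edges in [A_max f]: this set is invariant under [G], so losing
    an edge loses every listed edge of its orbit. *)
Lemma optimize f : equivariant f -> straight f -> Lip_minimal f ->
  exists h, [/\ optimal h, A_max h `<=` A_max f & ~ optimal f -> A_max h `<` A_max f].
Proof.
pose c f := count (fun e => `[< A_max f e >]) es.
have [n] := ubnP (c f); elim: n f => [//|n IHn] f cn feq fs fmin.
have [fopt|nopt] := pselect (optimal f); first by exists f; split.
have [v [Vv /not_optimal_atP[e0 [me0 [Ee0 e0v]] gate_v]]] :
    exists v, vert A v /\ not_optimal_at f v.
  apply: contrapT => nv; apply: nopt; split; first exact: PL.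
  by move=> v Vv nov; apply: nv; exists v.
have [w0 ve0] : exists w0, ends e0 v w0.
  have [a [b eab]] := edge_ends Ee0.
  have [->|->] := ends_vert eab Vv e0v; first by exists b.
  by exists a; apply: ends_sym.
have [fO _] := PL feq fs.
have L0 : 0 < Lip f by apply: Lip_gt0 => //; exists e0.
have [f' [f'eq f's Lf' sub]] :=
  descent reps trivB feq fs ve0 me0 L0 gate_v (straight_lipschitz_consts feq fs reps).
have LE : Lip f' = Lip f.
  by apply/eqP; rewrite eq_le Lf' fmin //; case: (PL f'eq f's).
have {}sub := sub LE.
have [||h [hopt hsub _]] := IHn f' _ f'eq f's.
- rewrite -ltnS; apply: leq_trans cn; rewrite ltnS.
  have [e [me nme]] : exists e, A_max f e /\ ~ A_max f' e.
    apply: contrapT => ne; apply: sub.2 => e me; apply: contrapT => nme.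
    by apply: ne; exists e.
  have [e1 [g [e1s eE]]] := reps.2 e me.1.
  rewrite eE in me nme; apply: (count_lt (x := e1)) => //.
  + by move=> e' /asboolP /sub.1 ?; apply/asboolP.
  + by apply/asboolP; apply/(A_max_act feq fs g).
  + by apply/asboolPn => me'; apply: nme; apply/(A_max_act f'eq f's g).
- by move=> f'' /fmin; rewrite LE.
have hf : A_max h `<` A_max f.
  case: sub => s1 s2; split; first exact: subset_trans hsub s1.
  by move=> s3; apply: s2; apply: subset_trans s3 hsub.
by exists h; split=> //; case: hf.
Qed.

(** * Comparison of a Lipschitz-minimal PL map with its straightening *)

Section Straightened.
Variables (f f' : A -> B).
Hypothesis fPL : PL_map f.
Hypothesis f'eq : equivariant f'.
Hypothesis f's : straight f'.
Hypothesis ff' : forall v, vert A v -> f' v = f v.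
Hypothesis fmin : Lip_minimal f.

Let fL : lipschitz_consts f !=set0.
Proof. by case: fPL => -[]. Qed.

Lemma straightened_Lip : Lip f' = Lip f.
Proof.
apply/eqP; rewrite eq_le fmin ?andbT; last by case: (PL f'eq f's).
apply: Lip_le; first exact: Lip_ge0.
apply: straight_lipschitz => // [|e a b eab]; first exact: Lip_ge0.
by have [_ _ Va Vb] := ends_memP eab; rewrite !ff' //; apply: Lip_lipschitz.
Qed.

Lemma straightened_A_max : A_max f' `<=` A_max f.
Proof.
move=> e me'; have [a [b eab]] := edge_ends me'.1; have [_ _ Va Vb] := ends_memP eab.
have := (straight_A_max f's eab).1 me'; rewrite straightened_Lip (ff' Va) (ff' Vb) => fab.
have [S [S0 cS _]] := fPL.2 e me'.1; split; first exact: me'.1.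
suff <- : S = Lip f by [].
apply/eqP; rewrite eq_le (constant_speed_le me'.1 fL cS) /=.
by rewrite -(ler_pM2r (ends_dist_gt0 eab)) -fab; apply: constant_speed_ge cS.
Qed.

(** The ends of [e] are stretched by exactly [Lip f], which leaves no slack in the triangle
    inequality: [f x] is forced to be the point of the geodesic that [f'] selects. *)
Lemma straightened_eq e x : A_max f' e -> e x -> f' x = f x.
Proof.
move=> me' ex; have [a [b eab]] := edge_ends me'.1; have [ea eb Va Vb] := ends_memP eab.
have := (straight_A_max f's eab).1 me'; rewrite straightened_Lip (ff' Va) (ff' Vb) => fab.
have h1 := Lip_lipschitz a x fL; have h2 := Lip_lipschitz x b fL.
have h3 := metric_triangle (f a) (f x) (f b).
have h4 := edge_dist_ends eab ex.
have h5 := straight_between f's eab ex; rewrite (ff' Va) (ff' Vb) in h5.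
have h6 : mdist (f a) (f' x) = Lip f * mdist a x.
  apply: (mulIf (lt0r_neq0 (ends_dist_gt0 eab))).
  by have := f's eab ea ex; rewrite (ff' Va) (ff' Vb) fab => ->; rewrite mulrAC.
have h7 : Lip f * mdist a b = Lip f * mdist a x + Lip f * mdist x b.
  by rewrite -h4 mulrDr.
apply: (between_unique h5); lra.
Qed.

Lemma straightened_germ v e e' : A_max f' e -> A_max f' e' -> e v -> e' v ->
  germ_equiv f v e e' -> germ_equiv f' v e e'.
Proof.
move=> me me' ev e'v.
(* The relation [Q] is kept general so that the statement serves both for the image filter of a germ
   and for its nondegeneracy. *)
have near e1 (Q : B -> B -> Prop) : A_max f' e1 -> e1 v ->
    (\forall y \near within e1 (nbhs v), Q (f y) (f v)) =
    (\forall y \near within e1 (nbhs v), Q (f' y) (f' v)).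
  move=> me1 e1v; rewrite (straightened_eq me1 e1v).
  by apply/propext; split=> h; apply: filterS2 h (withinT _ _) => y + e1y;
    rewrite (straightened_eq me1 e1y).
have img e1 : A_max f' e1 -> e1 v -> germ_image f v e1 = germ_image f' v e1.
  by move=> me1 e1v; apply/funext => P; apply: (near e1 (fun z _ => P z)).
case=> [->|[n1 n2 e12]]; [by left|right].
split; last by rewrite -!img.
  by rewrite /nondegenerate_germ -(near e (fun y z => y = z)).
by rewrite /nondegenerate_germ -(near e' (fun y z => y = z)).
Qed.

Lemma straightened_not_optimal : A_max f `<=` A_max f' -> ~ optimal f -> ~ optimal f'.
Proof.
move=> sub nopt [_ opt']; apply: nopt; split=> // v Vv /not_optimal_atP[e0 me0 gate_v].
apply: (opt' v Vv); apply/not_optimal_atP; exists e0.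
  by case: me0 => /sub me0 ?; split.
move=> e [me [Ee ev]]; apply: straightened_germ => //.
- by apply: sub; case: me0.
- by case: me0 => _ [].
- by apply: gate_v; split=> //; apply: straightened_A_max.
Qed.

End Straightened.

Lemma optimal_decrease f : PL_map f -> ~ optimal f -> Lip_minimal f ->
  exists h, optimal h /\ A_max h `<` A_max f.
Proof.
move=> fPL nopt fmin; have [[feq _ _] _] := fPL.
have [f' [f'eq f's ff']] := straighten (fun g v (_ : vert A v) => feq g v).
have f'min : Lip_minimal f' by move=> k /fmin; rewrite (straightened_Lip fPL f'eq f's ff' fmin).
have [h [hopt hsub hlt]] := optimize f'eq f's f'min.
have sub := straightened_A_max fPL f'eq f's ff' fmin.
(* Either straightening already removes an edge from [A_max f], or both maps have the same maximal
   edges and gates; then [f'] is not optimal and the descent removes one. *)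
exists h; split=> //; have [sub'|nsub] := pselect (A_max f `<=` A_max f').
  have [|h1 h2] := hlt; first exact: (straightened_not_optimal fPL).
  by split; [exact: subset_trans h1 sub|move=> fh; apply/h2/(subset_trans sub)].
by split; [exact: subset_trans hsub sub|move=> fh; apply/nsub/(subset_trans fh)].
Qed.

End Optimize.

(** * Positivity of Lipschitz constants on trees with edges *)

Section LipPositive.
Variables (R : realType) (p : nat) (Gs : 'I_p -> groupType) (F G : groupType).
Variable iota : forall o, {multiplicative free_factor Gs F o -> G}.
Variables A B : gtree R G.
Hypothesis hA : in_outer_space iota A.
Hypothesis hB : in_outer_space iota B.

(** If all of [G] fixes [b], then [G] is trivial or a conjugate of some factor [Gs i]; in the latter
    case the vertex of [A] with stabilizer conjugate to this factor is fixed too. *)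
Lemma outer_space_fixed_vertex (b : B) : (forall g, act g b = b) -> vert B b ->
  exists2 a : A, vert A a & forall g, act g a = a.
Proof.
move=> gb Vb; have stab_b g : stabilizer b g by apply: gb.
have [_ _ _ /(_ b Vb)[[i [_ [h stabE]]]|stab1]] := hB; last first.
  have [a Va] := tree_nonempty A; exists a => // g.
  by have := stab_b g; rewrite stab1 => ->; rewrite act_one.
have [_ _ /(_ i)[a [[Va [k stab_a]] _]] _] := hA.
exists a => // g; suff : stabilizer a g by [].
rewrite stab_a.
have : stabilizer b (h * (k^-1 * g * k) * h^-1)%g by [].
rewrite stabE => -[y yr /(congr1 (fun z => h^-1 * z * h)%g)].
rewrite -!mulgA !mulKg mulVg !mulg1 => yE.
by exists y => //; rewrite yE !mulgA mulgV mul1g -mulgA mulgV mulg1.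
Qed.

(** A surjective map with [Lip f = 0] makes [B] a point. Then [G] fixes a vertex of [A], and
    minimality reduces [A] to this vertex. *)
Lemma outer_space_Lip_gt0 (f : A -> B) : O_map f -> edge A !=set0 -> 0 < Lip f.
Proof.
move=> [feq fL fsurj] [e Ee]; rewrite lt_neqAle Lip_ge0 andbT; apply/eqP => L0.
have [b Vb] := tree_nonempty B.
have const x y : f x = f y.
  apply/mdist_positivity/eqP; rewrite eq_le mdist_ge0 andbT.
  by have := Lip_lipschitz x y fL; rewrite -L0 mul0r.
have allb y : y = b.
  by have [x <-] := fsurj y; have [x' <-] := fsurj b.
have [a Va ga] := outer_space_fixed_vertex (fun g => allb (act g b)) Vb.
have [_ [minA _] _ _] := hA.
have AE : [set a] = setT.
  apply: minA; [by exists a|exact: connected1|].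
  by move=> g x ->; rewrite ga.
have [c [d ecd]] := edge_ends Ee; apply: (ends_neq ecd).
have : [set a] c by rewrite AE. have : [set a] d by rewrite AE.
by move=> -> ->.
Qed.

End LipPositive.

(** * Compactness and discreteness modulo the group *)

Section UltraLimits.
Variables (I : Type) (U : set_system I).
Context {UU : UltraFilter U}.

Lemma ultra_finite_cover (J : eqType) (l : seq J) (Q : I -> J -> Prop) :
  (forall i, exists j, j \in l /\ Q i j) -> exists2 j, j \in l & U [set i | Q i j].
Proof.
(* Requiring the covering only on a member of [U] lets the induction discard a label whose set is
   not in [U]. *)
move=> cov; suff : U [set i | exists j, j \in l /\ Q i j] -> exists2 j, j \in l & U [set i | Q i j].
  by apply; apply: filterE.
elim: l {cov} => [|j l IHl].
  move=> UE; exfalso; apply: (@filter_not_empty _ U _); apply: filterS UE.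
  by move=> i [j []].
move=> Ujl; have [Uj|nUj] := in_ultra_setVsetC [set i | Q i j] UU.
  by exists j; rewrite // inE eqxx.
have [|k kl Uk] := IHl.
  apply: filterS (filterI Ujl nUj) => i [[k [+ Qk]] nQj].
  by rewrite inE => /orP[/eqP kj|kl]; [case: nQj; rewrite /= -kj|exists k].
by exists k; rewrite // inE kl orbT.
Qed.

Lemma filter_finite_forall (J : eqType) (l : seq J) (Q : I -> J -> Prop) :
  (forall j, j \in l -> U [set i | Q i j]) -> U [set i | forall j, j \in l -> Q i j].
Proof.
elim: l => [|j l IHl] Ul; first by apply: filterE.
have Ul' : U [set i | forall j, j \in l -> Q i j].
  by apply: IHl => k kl; apply: Ul; rewrite inE kl orbT.
have Uj : U [set i | Q i j] by apply: Ul; rewrite inE eqxx.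
apply: filterS (filterI Uj Ul') => i [Qj Ql] k.
by rewrite inE => /orP[/eqP -> //|/Ql].
Qed.

Lemma ultra_compact_limit (R : realType) (X : metricType R) (K : set X) (z : I -> X) :
  compact K -> U [set i | K (z i)] ->
  exists2 y, K y & forall eps : R, 0 < eps -> U [set i | mdist (z i) y < eps].
Proof.
move=> cK UK; have [y [Ky cl]] := cK (z @ U) _ UK; exists y => // eps eps0.
have [//|nU] := in_ultra_setVsetC [set i | mdist (z i) y < eps] UU.
have [||x [/= far near]] := cl [set x | ~ mdist x y < eps] (ball y eps).
- exact: nU.
- by apply: nbhsx_ballx.
by move: near; rewrite ballEmdist /= metric_sym.
Qed.

End UltraLimits.

Section FiniteQuotient.
Variables (R : realType) (G : groupType) (T : gtree R G) (es : seq (set T)).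
Hypothesis reps : edge_reps T es.
Implicit Types (e : set T) (a b u v x y : T) (g h : G).

(** By connectedness this occurs only in a tree reduced to one vertex, which representatives of
    edges do not see. *)
Lemma isolated_vertex p x : vert T p -> (forall e, edge T e -> ~ e x) -> x = p.
Proof.
move=> Vp iso; have [Vx|[e Ee ex]] := cover_point x; last by case: (iso e).
have [[//|[e w] s] xs _] := tree_connected Vx Vp.
by have [exw _] := (walk_cons _ _ _ _).1 xs; case: (iso e exw.1); case: (ends_memP exw).
Qed.

Lemma vertex_reps : exists vs : seq T, (forall v, v \in vs -> vert T v) /\
  forall v, vert T v -> exists v0 g, v0 \in vs /\ v = act g v0.
Proof.
have [p Vp] := tree_nonempty T.
have ends_list e : exists l : seq T, edge T e ->
    (forall v, v \in l -> vert T v) /\ (forall v, vert T v -> e v -> v \in l).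
  have [Ee|nEe] := pselect (edge T e); last by exists [::].
  have [a [b eab]] := edge_ends Ee; have [_ _ Va Vb] := ends_memP eab.
  exists [:: a; b] => _; split=> v; rewrite !inE; first by move=> /orP[] /eqP ->.
  by move=> Vv ev; have [->|->] := ends_vert eab Vv ev; rewrite eqxx ?orbT.
have [L LP] := choice ends_list.
exists (p :: flatten (map L es)); split=> v.
  rewrite inE => /orP[/eqP -> //|/flatten_mapP[e ees]].
  exact: (LP e (reps.1 e ees)).1.
move=> Vv; have [[e [Ee ev]]|ne] := pselect (exists e, edge T e /\ e v).
  have [e0 [g [e0s eE]]] := reps.2 e Ee.
  exists (act g^-1%g v), g; rewrite actVK; split=> //; rewrite inE; apply/orP; right.
  apply/flatten_mapP; exists e0 => //; apply: (LP e0 (reps.1 e0 e0s)).2.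
    exact: act_vert.
  by move: ev; rewrite eE => -[x ex <-]; rewrite actK.
exists p, 1%g; rewrite act_one inE eqxx; split=> //.
by apply: isolated_vertex => // e Ee ev; apply: ne; exists e.
Qed.

(** Each [b i] is translated into one of finitely many compact sets, the listed edges and [[set p]].
    One of these receives a [U]-large set of indices, and the ultrafilter converges there. *)
Lemma quotient_limit (I : Type) (U : set_system I) (b : I -> T) : UltraFilter U ->
  exists y, forall eps : R, 0 < eps -> U [set i | exists g, mdist (b i) (act g y) < eps].
Proof.
move=> UU; have [p Vp] := tree_nonempty T.
pose Q i (K : set T) := exists z, K z /\ exists g, b i = act g z.
have [|K Kl UK] := @ultra_finite_cover I U UU _ ([set p] :: es) Q.
  move=> i; have [[e [Ee eb]]|ne] := pselect (exists e, edge T e /\ e (b i)).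
    have [e0 [g [e0s eE]]] := reps.2 e Ee.
    exists e0; split; first by rewrite inE e0s orbT.
    by move: eb; rewrite eE => -[z e0z zE]; exists z; split=> //; exists g.
  exists [set p]; split; first by rewrite inE eqxx.
  exists p; split=> //; exists 1%g; rewrite act_one.
  by apply: isolated_vertex => // e Ee eb; apply: ne; exists e.
have cK : compact K.
  move: Kl; rewrite inE => /orP[/eqP ->|Kes]; first exact: compact_set1.
  by apply: edge_compact; apply: reps.1.
have zex i : exists z, Q i K -> K z /\ exists g, b i = act g z.
  have [[z zP]|nQ] := pselect (Q i K); first by exists z.
  by exists p.
have [z zP] := choice zex.
have [|y Ky ylim] := ultra_compact_limit (U := U) (z := z) cK.
  by apply: filterS UK => i /zP[].
exists y => eps eps0; apply: filterS (filterI UK (ylim eps eps0)) => i [/zP[_ [g bi]] zy].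
by exists g; rewrite bi act_isometry.
Qed.

(** The possible first vertices on a path from [y]: [y] itself if it is a vertex, otherwise the ends
    of its edge. *)
Definition exit y a : Prop := vert T a /\
  (vert T y /\ a = y \/ ~ vert T y /\ exists e, [/\ edge T e, e y & e a]).

Lemma exit_act g y a : exit y a -> exit (act g y) (act g a).
Proof.
move=> [Va ya]; split; first exact: act_vert.
case: ya => [[Vy ->]|[nVy [e [Ee ey ea]]]]; [left|right]; first by split=> //; apply: act_vert.
split; first by rewrite act_vertE.
by exists (act g @` e); split; [apply: act_edge|apply/act_imageP..].
Qed.

Lemma dist_exit_vert u v : vert T v ->
  exists2 a, exit u a & mdist u v = mdist u a + mdist a v.
Proof.
move=> Vv; have [Vu|nVu] := pselect (vert T u).
  by exists u; [split=> //; left|rewrite mdistxx add0r].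
have [//|[e Ee eu]] := cover_point u; have [a [b eab]] := edge_ends Ee.
have [ea eb Va Vb] := ends_memP eab.
have exit_e w : e w -> vert T w -> exit u w.
  by move=> ew Vw; split=> //; right; split=> //; exists e.
have [ev|nev] := pselect (e v).
  by exists v; [exact: exit_e|rewrite mdistxx addr0].
by have [uv|uv] := edge_exit eab eu nev; [exists a|exists b] => //; apply: exit_e.
Qed.

Lemma dist_exits u u' : exists a a', [/\ exit u a, exit u' a'
  & mdist u u' = mdist u a + mdist a a' + mdist a' u' \/
    mdist u u' = `|mdist u a - mdist u' a'|].
Proof.
have [Vu|nVu] := pselect (vert T u).
  have [a' ua' dE] := dist_exit_vert u' Vu.
  exists u, a'; split=> //; first by split=> //; left.
  by left; rewrite mdistxx add0r (metric_sym u u') dE (metric_sym u' a') (metric_sym a' u) addrC.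
have [//|[e Ee eu]] := cover_point u; have [a [b eab]] := edge_ends Ee.
have [ea eb Va Vb] := ends_memP eab.
have exit_e w : e w -> vert T w -> exit u w.
  by move=> ew Vw; split=> //; right; split=> //; exists e.
have [eu'|neu'] := pselect (e u').
  have [Vu'|nVu'] := pselect (vert T u').
    exists u', u'; split; [exact: exit_e|by split=> //; left|left].
    by rewrite !mdistxx !addr0.
  exists a, a; split; [exact: exit_e|by split=> //; right; split=> //; exists e|right].
  by rewrite (edge_dist eab eu eu') (metric_sym a u) (metric_sym a u').
have [c [ec Vc uc]] : exists c, [/\ e c, vert T c & mdist u u' = mdist u c + mdist c u'].
  by have [uu'|uu'] := edge_exit eab eu neu'; [exists a|exists b].
have [a' ua' dE] := dist_exit_vert u' Vc.
exists c, a'; split; [exact: exit_e|by []|left].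
rewrite uc (metric_sym c u') dE (metric_sym u' a') (metric_sym a' c).
by rewrite -addrA (addrC (mdist a' u')).
Qed.

(** Edge lengths take finitely many positive values, so a sum of them that is at most [C] has
    boundedly many terms. *)
Lemma vert_dist_discrete (C : R) : exists l : seq R,
  forall v w, vert T v -> vert T w -> mdist v w <= C -> mdist v w \in l.
Proof.
have len_ex e : exists r : R, edge T e ->
    0 < r /\ forall a b, ends e a b -> mdist a b = r.
  have [Ee|nEe] := pselect (edge T e); last by exists 0.
  have [a [b eab]] := edge_ends Ee; exists (mdist a b) => _.
  split=> [|a' b' eab']; first exact: ends_dist_gt0 eab.
  have [[-> ->] //|[-> ->]] := eq_set2 (etrans (esym eab'.2) eab.2).
  exact: metric_sym.
have [len lenP] := choice len_ex; pose Ls := map len es.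
have lenE e a b : ends e a b -> mdist a b \in Ls.
  move=> eab; have [e0 [g [e0s eE]]] := reps.2 e eab.1.
  apply/mapP; exists e0 => //.
  have := act_ends g^-1%g eab; rewrite eE act_imageM mulVg act_image1 => e0ab.
  by rewrite -((lenP e0 e0ab.1).2 _ _ e0ab) act_isometry.
have [m m0 mP] : exists2 m, 0 < m & forall r, r \in Ls -> m <= r.
  apply: (common_radius (P := fun r t => t <= r)) => [r s t tr st|r].
    exact: le_trans tr.
  move=> /mapP[e ees ->]; exists (len e) => //; exact: (lenP e (reps.1 e ees)).1.
have [N NP] : exists N : nat, C < m * N%:R.
  exists (Num.truncn (C / m)).+1; rewrite mulrC -ltr_pdivrMr //; exact: truncnS_gt.
(* [sums n] lists the sums of at most [n] edge lengths; [N] exceeds [C] divided by the lower bound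
   [m] of these lengths. *)
pose fix sums n : seq R := if n is n'.+1 then 0 :: [seq r + t | r <- Ls, t <- sums n'] else [:: 0].
have walk_sum s v n : walk (vert T) (edge T) v s -> (size s <= n)%N ->
    chain_length v (unzip2 s) \in sums n.
  elim: s v n => [|[e w] s IHs] v n; first by case: n => [|n] _ _ /=; rewrite inE eqxx.
  case: n => // n /walk_cons[evw ws] sn; rewrite inE; apply/orP; right.
  by apply/allpairsP; exists (mdist v w, chain_length w (unzip2 s)); split=> //;
    [apply: lenE evw|apply: IHs].
have walk_ge s v : walk (vert T) (edge T) v s ->
    m * (size s)%:R <= chain_length v (unzip2 s).
  elim: s v => [|[e w] s IHs] v /=; first by rewrite mulr0.
  move=> /walk_cons[evw ws]; rewrite -natr1 mulrDr mulr1 addrC lerD ?IHs //.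
  by apply: mP; apply: lenE evw.
exists (sums N) => v w Vv Vw; have [s [vs _ ->]] := vert_dist_walk Vv Vw => sC.
apply: walk_sum => //; rewrite leqNgt; apply/negP => Ns.
have := le_trans (walk_ge s v vs) sC; rewrite leNgt => /negP; apply.
by apply: lt_le_trans NP _; rewrite ler_pM2l // ler_nat ltnW.
Qed.

(** By [dist_exits] such a distance is built from a distance between vertices and distances to
    exits; the latter are unchanged by translation, so finitely many occur for the orbits of [Y]. *)
Lemma orbit_dist_discrete (Y : seq T) (C : R) : exists l : seq R,
  forall y y' g g', y \in Y -> y' \in Y -> mdist (act g y) (act g' y') <= C ->
    mdist (act g y) (act g' y') \in l.
Proof.
have [lV lVP] := vert_dist_discrete C.
have exits_ex y : exists l : seq R, forall a, exit y a -> mdist y a \in l.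
  have [Vy|nVy] := pselect (vert T y).
    by exists [:: 0] => a [_ [[_ ->]|[]//]]; rewrite mdistxx inE.
  have [//|[e Ee ey]] := cover_point y; have [a [b eab]] := edge_ends Ee.
  exists [:: mdist y a; mdist y b] => c [Vc [[]//|[_ [e' [Ee' e'y e'c]]]]].
  have ee : e' = e by apply: edge_unique Ee' Ee e'y ey nVy.
  rewrite ee in e'c; rewrite !inE.
  by have [->|->] := ends_vert eab Vc e'c; rewrite eqxx ?orbT.
have [exits exitsP] := choice exits_ex; pose lE := flatten (map exits Y).
have lEP y g a : y \in Y -> exit (act g y) a -> mdist (act g y) a \in lE.
  move=> yY ea; apply/flatten_mapP; exists y => //.
  rewrite -(act_isometry g^-1%g) actK; apply: exitsP.
  by rewrite -{1}(actK g y); apply: exit_act.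
exists ([seq r + t | r <- [seq r + t | r <- lE, t <- lV], t <- lE] ++
        [seq `|r - t| | r <- lE, t <- lE]).
move=> y y' g g' yY y'Y; have [a [a' [ya ya' dE]]] := dist_exits (act g y) (act g' y').
have ya_in := lEP y g a yY ya; have ya'_in := lEP y' g' a' y'Y ya'.
rewrite mem_cat; case: dE => -> dC; apply/orP; [left|right].
  apply/allpairsP; exists (mdist (act g y) a + mdist a a', mdist a' (act g' y')).
  split=> //=; last by rewrite metric_sym.
  apply/allpairsP; exists (mdist (act g y) a, mdist a a'); split=> //=.
  apply: lVP; [by case: ya|by case: ya'|apply: le_trans dC].
  by rewrite -addrA addrCA lerDl addr_ge0 ?mdist_ge0.
by apply/allpairsP; exists (mdist (act g y) a, mdist (act g' y') a').
Qed.

Lemma orbit_dist_gap (Y : seq T) (C : R) : exists2 delta : R, 0 < delta &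
  forall y y' g g', y \in Y -> y' \in Y ->
    mdist (act g y) (act g' y') < C + delta -> mdist (act g y) (act g' y') <= C.
Proof.
(* Only finitely many values are at most [C + 1]; [delta] is at most [1] and at most the gap between
   [C] and the next value. *)
have [l lP] := orbit_dist_discrete Y (C + 1).
have [d d0 dP] : exists2 d, 0 < d & forall r, r \in l -> C < r -> C + d <= r.
  apply: (common_radius (P := fun r d => C < r -> C + d <= r)) => [r s t tr st /tr|r _].
    by move=> ?; lra.
  have [Cr|rC] := ltP C r; last by exists 1.
  by exists (r - C); rewrite ?subr_gt0 // => _; lra.
exists (Num.min d 1); first by rewrite lt_min d0 ltr01.
move=> y y' g g' yY y'Y lt_d; rewrite leNgt; apply/negP => gtC.
have h1 : Num.min d 1 <= d by rewrite ge_min lexx.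
have h2 : Num.min d 1 <= 1 by rewrite ge_min lexx orbT.
have := dP _ (lP y y' g g' yY y'Y _) gtC; lra.
Qed.

End FiniteQuotient.

(** * Existence of a minimal Lipschitz constant *)

Section Minimizer.
Variables (R : realType) (G : groupType) (A B : gtree R G).
Variables (esA : seq (set A)) (esB : seq (set B)).
Hypothesis repsA : edge_reps A esA.
Hypothesis repsB : edge_reps B esB.
Hypothesis trivB : trivial_edge_stabilizers B.
Hypothesis minB : minimal_action B.

Lemma Lip_minimal_exists : (exists f0 : A -> B, O_map f0) ->
  exists f : A -> B, [/\ equivariant f, straight f & Lip_minimal f].
Proof.
move=> [f0 f0O]; pose Lips := [set Lip f | f in [set f : A -> B | O_map f]].
pose lam := inf Lips.
have Lips_inf : has_inf Lips.
  by split; [exists (Lip f0), f0|exists 0 => _ [f _ <-]; apply: Lip_ge0].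
have lam_ge0 : 0 <= lam.
  by apply: lb_le_inf; [case: Lips_inf|move=> _ [f _ <-]; apply: Lip_ge0].
have seq_ex (n : nat) : exists f : A -> B, O_map f /\ Lip f < lam + n.+1%:R^-1.
  have [_ [f fO <-] lt_f] := @inf_adherent _ Lips n.+1%:R^-1 ltac:(by rewrite invr_gt0) Lips_inf.
  by exists f.
have [F FP] := choice seq_ex.
(* One ultrafilter serves all vertices, so finitely many limits are approached at the same index
   [n]. *)
have [U [UU sub_U]] := ultraFilterLemma eventually_filter.
have [vA [vA_vert vA_reps]] := vertex_reps repsA.
have [vB [vB_vert vB_reps]] := vertex_reps repsB.
have [lim limP] := choice (fun v => quotient_limit repsB (fun n => F n v) UU).
(* The representatives [vB] account for the images of vertices with nontrivial stabilizer, which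
   must not be moved. *)
pose Y := map lim vA ++ vB.
pose orbY (y : B) := exists y0 g, y0 \in Y /\ y = act g y0.
have approx (eps : R) : 0 < eps -> exists f : A -> B, [/\ equivariant f, straight f,
    (forall v, vert A v -> orbY (f v)) &
    forall e a b, ends e a b -> mdist (f a) (f b) <= (lam + eps) * mdist a b + 2 * eps].
  move=> eps0.
  have near_lim : U [set n | forall v, v \in vA -> exists g, mdist (F n v) (act g (lim v)) < eps].
    by apply: filter_finite_forall => v _; apply: limP.
  have near_inf : U [set n | n.+1%:R^-1 < eps].
    by apply: sub_U; apply: (near_infty_natSinv_lt (PosNum eps0)).
  have [n [n_lim n_eps]] := @filter_ex _ U _ _ (filterI near_lim near_inf).
  have [[Feq FL _] FLip] := FP n.
  pose P (x : A) (y : B) := orbY y /\ mdist (F n x) y < eps.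
  have [phi [phi_eq phiP]] : exists phi : A -> B,
      (forall g v, vert A v -> phi (act g v) = act g (phi v)) /\
      (forall v, vert A v -> P v (phi v)).
    apply: equivariant_choice => [g x y [[y0 [h [y0Y ->]]] xy]|x Vx].
      split; last by rewrite Feq act_isometry.
      by exists y0, (g * h)%g; rewrite act_mul.
    (* The image of a vertex with nontrivial stabilizer is a vertex already. *)
    have [free|] := pselect (forall h, act h x = x -> h = 1%g).
      have [v [g [vvA xE]]] := vA_reps x Vx; have [h vh] := n_lim v vvA.
      exists (act g (act h (lim v))); split.
        split; last by rewrite xE Feq act_isometry.
        exists (lim v), (g * h)%g; rewrite act_mul mem_cat; split=> //.
        by apply/orP; left; apply: map_f.
      by move=> k /free ->; rewrite act_one.
    move=> /existsNP[h /not_implyP[hx h1]].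
    exists (F n x); split; last by move=> g gx; rewrite -Feq gx.
    split; last by rewrite mdistxx.
    have VF : vert B (F n x).
      apply: contrapT => nV; apply: h1; apply: (stabilizer_interior trivB nV).
      by rewrite -Feq hx.
    have [y0 [g [y0vB FE]]] := vB_reps _ VF.
    by exists y0, g; rewrite mem_cat y0vB orbT.
  have [f [feq fs fV]] := straighten phi_eq.
  exists f; split=> // [v Vv|e a b eab]; first by rewrite fV //; case: (phiP v Vv).
  have [_ _ Va Vb] := ends_memP eab; rewrite !fV //.
  have [_ ha] := phiP a Va; have [_ hb] := phiP b Vb.
  have hab := Lip_lipschitz a b FL.
  have lt_Lip : Lip (F n) * mdist a b <= (lam + eps) * mdist a b.
    by rewrite ler_wpM2r ?mdist_ge0 // ltW // (lt_trans FLip) // ltrD2l.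
  have := metric_triangle (phi a) (F n a) (phi b).
  have := metric_triangle (F n a) (F n b) (phi b).
  by rewrite (metric_sym (phi a) (F n a)); lra.
have [d d0 dP] : exists2 d, 0 < d & forall e, e \in esA -> forall a b, ends e a b ->
    forall y y' g g', y \in Y -> y' \in Y ->
    mdist (act g y) (act g' y') < lam * mdist a b + d ->
    mdist (act g y) (act g' y') <= lam * mdist a b.
  apply: common_radius => [e s t Pt st a b eab y y' g g' yY y'Y lt_s|e ees].
    by apply: Pt eab _ _ _ _ yY y'Y _; lra.
  have [a [b eab]] := edge_ends (repsA.1 e ees).
  have [d d0 dP] := orbit_dist_gap repsB Y (lam * mdist a b).
  exists d => // a' b' eab'; have [[-> ->] //|[-> ->]] := eq_set2 (etrans (esym eab'.2) eab.2).
  by rewrite (metric_sym b).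
have [eps eps0 epsP] : exists2 eps, 0 < eps & forall e, e \in esA ->
    forall a b, ends e a b -> eps * mdist a b + 2 * eps < d.
  apply: common_radius => [e s t Pt st a b eab|e ees].
    have : s * mdist a b <= t * mdist a b by rewrite ler_wpM2r ?mdist_ge0.
    by have := Pt a b eab; lra.
  have [a [b eab]] := edge_ends (repsA.1 e ees).
  have k0 : 0 < mdist a b + 2 by rewrite addr_gt0 // (ends_dist_gt0 eab).
  (* This value makes [eps * mdist a b + 2 * eps] equal to [d / 2]. *)
  exists (d / 2 / (mdist a b + 2)); first by rewrite !divr_gt0.
  move=> a' b' eab'; have -> : mdist a' b' = mdist a b.
    by have [[-> ->] //|[-> ->]] := eq_set2 (etrans (esym eab'.2) eab.2); apply: metric_sym.
  rewrite [2 * _]mulrC -mulrDr mulfVK ?lt0r_neq0 //; lra.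
have [f [feq fs fY f_le]] := approx eps eps0.
exists f; split=> // f' f'O; apply: (@le_trans _ _ lam); last first.
  by apply: ge_inf; [case: Lips_inf|exists f'].
apply: Lip_le => //; apply: straight_lipschitz => //.
apply: (equivariant_speed feq repsA) => e a b ees eab.
have [_ _ Va Vb] := ends_memP eab.
have [ya [ga [yaY fa]]] := fY a Va; have [yb [gb [ybY fb]]] := fY b Vb.
(* The distance lies below [lam * mdist a b + d], so the gap forces it down to [lam * mdist a b]. *)
rewrite fa fb; apply: (dP e ees a b eab) => //; rewrite -fa -fb.
have := f_le e a b eab; have := epsP e ees a b eab; rewrite mulrDl; lra.
Qed.

End Minimizer.

(** An equivariant map on vertices exists because stabilizers match: a vertex whose stabilizer is
    conjugate to a factor goes to a suitable translate of the vertex of [B] of the same type, a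
    vertex with trivial stabilizer anywhere. *)
Lemma outer_space_O_map (R : realType) (p : nat) (Gs : 'I_p -> groupType) (F G : groupType)
    (iota : forall o, {multiplicative free_factor Gs F o -> G}) (A B : gtree R G)
    (es : seq (set A)) : in_outer_space iota A -> in_outer_space iota B ->
  edge_reps A es -> exists f : A -> B, O_map f.
Proof.
move=> [_ _ _ C3A] [_ [minB _] C2B _] reps.
have [q Vq] := tree_nonempty B.
have [||phi [phi_eq _]] := @equivariant_choice R G A B (fun _ _ => True).
- by [].
- move=> x Vx; have [[i [_ [h stab_x]]]|stab1] := C3A x Vx; last first.
    exists q; split=> // g gx; have : stabilizer x g by [].
    by rewrite stab1 => ->; rewrite act_one.
  have [w [[Vw [k stab_w]] _]] := C2B i.
  exists (act h (act k^-1%g w)); split=> // g gx; have : stabilizer x g by [].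
  rewrite stab_x => -[z zr <-].
  have : stabilizer w (k * z * k^-1)%g by rewrite stab_w; exists z.
  rewrite /stabilizer /= !act_mul => wE.
  by rewrite !actK -{2}wE actK.
have [f [feq fs _]] := straighten phi_eq.
by exists f; case: (straight_PL_map feq fs reps minB).
Qed.

Theorem corollary6p8 (R : realType) (p k : nat)
    (Gs : 'I_p -> groupType) (F : groupType) (x : 'I_k -> F)
    (hF : is_free_group x)
    (G : groupType) (iota : forall o, {multiplicative free_factor Gs F o -> G})
    (hG : is_free_product iota)
    (A B : gtree R G)
    (hA : in_outer_space iota A) (hB : in_outer_space iota B) :
  (exists h : A -> B, optimal h) /\
  (forall f : A -> B, PL_map f -> ~ optimal f ->
     (forall f' : A -> B, O_map f' -> Lip f <= Lip f') ->
     exists h : A -> B, optimal h /\ A_max h `<` A_max f).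
Proof.
have [esA repsA] := outer_space_edge_reps hF hG hA.
have [esB repsB] := outer_space_edge_reps hF hG hB.
have [_ [minB trivB] _ _] := hB.
have Lip_gt0 := outer_space_Lip_gt0 hA hB.
split=> [|f fPL nopt fmin]; last exact: optimal_decrease repsA trivB minB Lip_gt0 f fPL nopt fmin.
have [f [feq fs fmin]] :=
  Lip_minimal_exists repsA repsB trivB (outer_space_O_map hA hB repsA).
by have [h [hopt _ _]] := optimize repsA trivB minB Lip_gt0 feq fs fmin; exists h.
Qed.
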